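(* Let $b>a>0$, $0\leq\rho<\frac12<\theta\leq1$, $s\geq0$ and $m\in[1,2]$. Let $\chi_{\mathrm{int}}\in C^\infty$ be a cut-off function supported in $\{\xi\in\mathbb{R}^2:|\xi|<\varepsilon\}$ with $\varepsilon>0$ sufficiently small. Then there is a constant $C>0$, independent of $t$ and $U_0$, such that for every $U_0\in L^m$ the solution $U$ of $$U_t+\tfrac12B_0(-\Delta)^{\rho}U+iB_1(-\Delta)^{\frac12}U+\tfrac12B_0(-\Delta)^{\theta}U=0\quad (x\in\mathbb{R}^2,\ t>0),\qquad U(0,x)=U_0(x),$$ and the solution $\widetilde U=\widetilde U(t,x;\rho,\theta)$ of the reference system (defined in the context) with initial data $\widetilde U(0,x)=T_1^{-1}U_0(x)$ satisfy, for all $t\geq0$, $$\left\|\chi_{\mathrm{int}}(D)\left(U(t,\cdot)-T_1\widetilde U(t,\cdot;\rho,\theta)\right)\right\|_{\dot H^s}\leq C(1+t)^{-\frac{s}{2-2\rho}-\frac{2-m}{m(2-2\rho)}-q(\rho,\theta)}\|U_0\|_{L^m},$$ where $$q(\rho,\theta)=\begin{cases}\dfrac{2\theta-1}{2-2\rho},&\text{if }\rho+\theta<1,\\[2mm]\dfrac{1-2\rho}{2-2\rho},&\text{if }\rho+\theta\geq1.\end{cases}$$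
   Context: $U,U_0,\widetilde U$ take values in $\mathbb{C}^4$. The matrices are $$B_0=\begin{pmatrix}1&0&1&0\\0&1&0&1\\1&0&1&0\\0&1&0&1\end{pmatrix},\quad B_1=\operatorname{diag}(-b,-a,b,a),\quad T_1=\begin{pmatrix}-1&0&1&0\\0&-1&0&1\\1&0&1&0\\0&1&0&1\end{pmatrix},$$ $$M_1=\operatorname{diag}(b^2,a^2,-b^2,-a^2),\qquad M_2=\operatorname{diag}(0,0,1,1).$$ The reference system for $\widetilde U$ ($x\in\mathbb{R}^2$, $t>0$) is: - if $\rho+\theta<1$: $\widetilde U_t+M_1(-\Delta)^{1-\rho}\widetilde U+M_2(-\Delta)^{\rho}\widetilde U+M_2(-\Delta)^{\theta}\widetilde U=0$; - if $\rho+\theta=1$: $\widetilde U_t+(M_1+M_2)(-\Delta)^{1-\rho}\widetilde U+M_2(-\Delta)^{\rho}\widetilde U=0$; - if $\rho+\theta>1$: $\widetilde U_t+M_1(-\Delta)^{1-\rho}\widetilde U+M_2(-\Delta)^{\rho}\widetilde U=0$. All solutions are understood on the Fourier side, i.e. for each $\xi$ the Fourier transform in $x$ solves the linear ODE system obtained by replacing $(-\Delta)^{\sigma}$ by $|\xi|^{2\sigma}$, with initial value the Fourier transform of the initial data; only small frequencies $|\xi|<\varepsilon$ enter the estimate. $\chi_{\mathrm{int}}(D)$ is the Fourier multiplier with symbol $\chi_{\mathrm{int}}(\xi)$. $\dot H^s$ is the Riesz potential space on $\mathbb{R}^2$ based on $L^2$, so $\|f\|_{\dot H^s}$ is, up to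 a constant, $\||\xi|^s\hat f\|_{L^2}$. *)

(* Defs.v *)
From HB Require Import structures.
From mathcomp Require Import all_boot all_order all_algebra.
From mathcomp Require Import complex.
From mathcomp Require Import all_classical all_reals all_analysis.

Set Implicit Arguments.
Unset Strict Implicit.
Unset Printing Implicit Defensive.
Import Order.TTheory GRing.Theory Num.Theory.
Import numFieldNormedType.Exports.

Local Open Scope classical_set_scope.
Local Open Scope ring_scope.
Local Open Scope complex_scope.

Section Plane.
Context {R : realType}.
Implicit Types (x xi : R * R) (f g : R * R -> 'cV[R[i]]_4) (p : \bar R).

Definition leb2 :
    {measure set (measurableTypeR R * measurableTypeR R) -> \bar R} :=
  ((@lebesgue_measure R) \x (@lebesgue_measure R))%E.

(* The library norm on R * R is the sup norm. *)
Definition enorm x : R := Num.sqrt (x.1 ^+ 2 + x.2 ^+ 2).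

Definition dotp x xi : R := x.1 * xi.1 + x.2 * xi.2.

(* Euclidean norm on C^4; normc is the R-valued modulus. *)
Definition cvnorm (v : 'cV[R[i]]_4) : R :=
  Num.sqrt (\sum_i ComplexField.Normc.normc (v i 0) ^+ 2).

Definition vmeasurable f : Prop := forall i,
  measurable_fun setT
    (fun x : measurableTypeR R * measurableTypeR R => complex.Re (f x i 0)) /\
  measurable_fun setT
    (fun x : measurableTypeR R * measurableTypeR R => complex.Im (f x i 0)).

Definition Lp_norm p f : \bar R := Lnorm leb2 p (fun x => (cvnorm (f x))%:E).

Definition in_Lp p f : Prop := vmeasurable f /\ (Lp_norm p f < +oo)%E.

Definition cintegral (h : R * R -> R[i]) : R[i] :=
  Rintegral leb2 setT (fun x => complex.Re (h x)) +i*
  Rintegral leb2 setT (fun x => complex.Im (h x)).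

Definition cexpi (y : R) : R[i] := cos y +i* sin y.

(* The unitary normalisation: (2 pi)^(-n/2) with n = 2. *)
Definition fourier_L1 f xi : 'cV[R[i]]_4 :=
  \col_i (((2 * pi)^-1)%:C * cintegral (fun x => cexpi (- dotp x xi) * f x i 0)).

(* [is_fourier m f g]: the value at [f] of the continuous extension
   L^m -> L^(m') of [fourier_L1] from L^1 `&` L^m (Hausdorff-Young, 1 <= m <= 2)
   is (the class of) [g]. *)
Definition is_fourier (m : R) f g : Prop :=
  vmeasurable g /\
  exists u : nat -> R * R -> 'cV[R[i]]_4,
    [/\ forall n, in_Lp 1%:E (u n),
        forall n, in_Lp m%:E (u n),
        Lp_norm m%:E (fun x => u n x - f x) @[n --> \oo] --> 0%E &
        Lp_norm (hoelder_conjugate m%:E)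
          (fun xi => fourier_L1 (u n) xi - g xi) @[n --> \oo] --> 0%E].

(* The homogeneous norm of the function with Fourier transform [v]. *)
Definition Hdot_norm_hat (s : R) (v : R * R -> 'cV[R[i]]_4) : \bar R :=
  Lp_norm 2%:E (fun xi => (enorm xi `^ s)%:C *: v xi).

Fixpoint Ck (k : nat) (h : R * R -> R) : Prop :=
  if k is k'.+1 then
    (forall x, differentiable h x) /\ forall v, Ck k' (fun x => 'D_v h x)
  else continuous h.

Definition smooth (h : R * R -> R) : Prop := forall k, Ck k h.

Definition tsupport (h : R * R -> R) : set (R * R) :=
  closure [set x | h x != 0].

(* Symbol of the fractional power (-Delta)^sigma; the value at xi = 0 is 1 when
   sigma = 0. *)
Definition lap (sigma : R) xi : R[i] := (enorm xi `^ (2 * sigma))%:C.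

(* [v] solves, for each frequency xi, the linear system v_t + A(xi) v = 0 for
   t > 0 with initial value v0(xi). Derivatives and limits are real ones, taken
   on real and imaginary parts, since R[i] is not a normed module over R. *)
Definition solves (A : R * R -> 'M[R[i]]_4) (v0 : R * R -> 'cV[R[i]]_4)
    (v : R -> R * R -> 'cV[R[i]]_4) : Prop :=
  forall xi,
  [/\ v 0 xi = v0 xi,
      forall i,
        complex.Re (v t xi i 0) @[t --> 0^'+] --> complex.Re (v0 xi i 0) /\
        complex.Im (v t xi i 0) @[t --> 0^'+] --> complex.Im (v0 xi i 0) &
      forall t : R, 0 < t -> forall i,
        is_derive t 1 (fun tau => complex.Re (v tau xi i 0))
          (complex.Re ((- (A xi *m v t xi)) i 0)) /\
        is_derive t 1 (fun tau => complex.Im (v tau xi i 0))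
          (complex.Im ((- (A xi *m v t xi)) i 0))].

End Plane.

Section Systems.
Context {R : realType}.
Implicit Types (a b rho theta : R) (xi : R * R).

Definition mx4 (rows : seq (seq R[i])) : 'M[R[i]]_4 :=
  \matrix_(i, j) (nth [::] rows i)`_j.

Definition diag4 (d : seq R) : 'M[R[i]]_4 := diag_mx (\row_j (d`_j)%:C).

Definition B0 : 'M[R[i]]_4 :=
  mx4 [:: [:: 1; 0; 1; 0];
          [:: 0; 1; 0; 1];
          [:: 1; 0; 1; 0];
          [:: 0; 1; 0; 1]].

Definition B1 a b : 'M[R[i]]_4 := diag4 [:: - b; - a; b; a].

Definition T1 : 'M[R[i]]_4 :=
  mx4 [:: [:: -1; 0; 1; 0];
          [:: 0; -1; 0; 1];
          [:: 1; 0; 1; 0];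
          [:: 0; 1; 0; 1]].

Definition M1 a b : 'M[R[i]]_4 :=
  diag4 [:: b ^+ 2; a ^+ 2; - b ^+ 2; - a ^+ 2].

Definition M2 : 'M[R[i]]_4 := diag4 [:: 0; 0; 1; 1].

Definition symbol a b rho theta xi : 'M[R[i]]_4 :=
  lap rho xi *: (2^-1 *: B0) + lap 2^-1 xi *: ('i%C *: B1 a b)
  + lap theta xi *: (2^-1 *: B0).

Definition ref_symbol a b rho theta xi : 'M[R[i]]_4 :=
  if rho + theta < 1 then
    lap (1 - rho) xi *: M1 a b + lap rho xi *: M2 + lap theta xi *: M2
  else if rho + theta == 1 then
    lap (1 - rho) xi *: (M1 a b + M2) + lap rho xi *: M2
  else
    lap (1 - rho) xi *: M1 a b + lap rho xi *: M2.

Definition q rho theta : R :=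
  if rho + theta < 1 then (2 * theta - 1) / (2 - 2 * rho)
  else (1 - 2 * rho) / (2 - 2 * rho).

(* invmx is the identity on singular matrices. *)
Lemma T1_unit : T1 \in unitmx.
Proof.
have H : T1 *m (2^-1 *: T1) = 1%:M.
  rewrite -scalemxAr; apply/matrixP => i j.
  rewrite !mxE !big_ord_recl big_ord0 !mxE.
  case: i => -[|[|[|[|//]]]] ?; case: j => -[|[|[|[|//]]]] ? /=;
  rewrite ?(mulr0, mul0r, mulr1, mul1r, mulrN1, mulN1r, opprK, addr0, add0r,
    addNr, subrr) //= -?mulr2n ?mulVf ?pnatr_eq0 //.
by case/mulmx1_unit: H.
Qed.

End Systems.

(* Main.v *)
(* For fixed xi the system splits into two real 2x2 systems in the unknowns
   U_(j+2) - U_j and U_j + U_(j+2), which an explicit change of unknowns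
   diagonalises. Comparing eigenvalues with those of the reference system gives
     |U - T1 Utilde| <= C |xi|^(1 - 2 rho) exp(- c |xi|^(2 - 2 rho) t) |U0hat|
   for small xi, in all three regimes of (rho, theta).

   The L^m estimate then follows without interpolation theory. The square of the
   resulting multiplier is at most al times a Cauchy kernel of width
   (1 + t)^(-1/(2 - 2 rho)), of integral of order al (1 + t)^(-2/(2 - 2 rho)).
   Truncate U0 at a level la: the large part is in L^1, with bounded Fourier
   transform, and the small part is in L^2, where a local form of Plancherel's
   inequality (a TT* argument with a compactly supported weight) applies. At the
   optimal la the two contributions balance and give the rate of the theorem. *)
Require Import Defs.
From HB Require Import structures.
From mathcomp Require Import all_boot all_order all_algebra.
From mathcomp Require Import complex ring lra.
From mathcomp Require Import all_classical all_reals all_analysis.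
From mathcomp Require Import measurable_realfun.

Set Implicit Arguments.
Unset Strict Implicit.
Unset Printing Implicit Defensive.
Import Order.TTheory GRing.Theory Num.Theory.
Import numFieldNormedType.Exports.

Local Open Scope classical_set_scope.
Local Open Scope ring_scope.
Local Open Scope complex_scope.

(** * Decay of scalar modes and the slow root *)

Section TwoModes.
Context {R : realType}.
Implicit Types (p t : R).

(** Dropping [|xi|^(2 theta)] from the damping [|xi|^(2 rho) + |xi|^(2 theta)] changes it by a
    relative amount of at most [e = |xi|^(1 - 2 rho)], because [2 theta >= 1], and the mixing [d] of
    the slow and fast modes has the same order. Hence every error carries one factor [e], and a
    single computation serves the three regimes. It yields the rate [(1 - 2 rho) / (2 - 2 rho)],
    which is faster than [q] when [rho + theta < 1]. An error in a decay rate also produces a factor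
    [t], paid for by part of the exponent.

    Data in L^m have a transform only as a limit. The estimates are therefore proved for integrable
    functions, whose transform is a pointwise integral, and one sufficiently close approximant
    carries them over. The compactly supported weight serves twice: its own transform is an
    integrable kernel, which gives the L^2 bound, and its finite mass lets the norm of L^(m'),
    [m' >= 2], control the error of the approximant in weighted L^2. Cosine and sine transforms are
    kept apart so that all integrals are real. *)

Lemma is_derive_decay (f : R -> R) p t : 0 < t ->
  is_derive t 1 f (- (p * f t)) ->
  is_derive t 1 (fun u => f u * expR (p * u)) 0.
Proof.
move=> t0 df.
apply: is_derive_eq.
rewrite /GRing.scale /=; ring.
Qed.

(** The mean value theorem makes [f t * expR (p * t)] constant on [t > 0]. As the equation holds for
    positive times only, the constant is identified through the right limit at 0. *)
Lemma decay_ode (f : R -> R) p (f0 : R) :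
  f x @[x --> 0^'+] --> f0 ->
  (forall t, 0 < t -> is_derive t 1 f (- (p * f t))) ->
  forall t, 0 < t -> f t = f0 * expR (- (p * t)).
Proof.
move=> f0l df t t0.
pose g (u : R) := f u * expR (p * u).
have dg (u : R) : 0 < u -> is_derive u 1 g 0 by move=> u0; apply: (@is_derive_decay f p u u0); exact: df.
have gc (u : R) : 0 < u -> u <= t -> g u = g t.
  move=> u0 ut.
  have [||x _] := @MVT_segment R g (fun=> 0) u t ut.
  - by move=> x; rewrite in_itv/= => /andP[ux _]; apply/dg/(lt_trans u0).
  - apply: derivable_within_continuous => x; rewrite in_itv/= => /andP[ux _].
    by have [] := dg x (lt_le_trans u0 ux).
  - by rewrite mul0r => /eqP; rewrite subr_eq0 eq_sym => /eqP.
have : g x @[x --> 0^'+] --> f0 * expR (p * 0).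
  apply: cvgM => //; apply: (@cvg_comp _ _ _ ( *%R p) expR _ (nbhs (p * 0))).
    by apply: cvgMr; exact: cvg_at_right_filter.
  exact: continuous_expR.
have : g x @[x --> 0^'+] --> g t.
  apply: cvg_near_cst; near=> x; apply: gc => //.
  by near: x; exact: nbhs_right_le.
move=> /(cvg_unique _) /[apply].
rewrite mulr0 expR0 mulr1 => <- //.
by rewrite /g -mulrA -expRD subrr expR0 mulr1.
Unshelve. all: by end_near.
Qed.

(** For [x <= y] the difference is [expR (- x) * (1 - expR (- (y - x)))], and
    [1 - expR (- h) <= h]. *)
Lemma normB_expRN_le (x y z : R) : z <= x -> z <= y ->
  `|expR (- x) - expR (- y)| <= `|x - y| * expR (- z).
Proof.
wlog xy : x y / x <= y.
  move=> H zx zy; have [xy|/ltW yx] := leP x y; first exact: H.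
  by rewrite distrC (distrC x); exact: H.
move=> zx zy.
have exy : expR (- y) <= expR (- x) by rewrite ler_expR; lra.
rewrite ger0_norm ?subr_ge0// distrC ger0_norm ?subr_ge0//.
have -> : expR (- y) = expR (- x) * expR (- (y - x)).
  by rewrite -expRD; congr expR; ring.
have h1 := expR_ge1Dx (- (y - x)).
have h2 : expR (- x) <= expR (- z) by rewrite ler_expR; lra.
have h3 := expR_ge0 (- x).
nra.
Qed.

(** Half of the decay absorbs the linear factor: [u * expR (- u) <= 1] at [u = x / 4]. *)
Lemma mul_expRN_le (x : R) : x * expR (- (x / 2)) <= 4 * expR (- (x / 4)).
Proof.
have -> : - (x / 2) = - (x / 4) + - (x / 4) by field.
rewrite expRD mulrA ler_pM2r ?expR_gt0//.
have h1 := expR_ge1Dx (x / 4).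
have h2 : expR (x / 4) * expR (- (x / 4)) = 1 by rewrite -expRD subrr expR0.
have h3 := expR_ge0 (- (x / 4)).
nra.
Qed.

(* [d] is the small root of the characteristic equation; the change of unknowns
   [X + d Y], [Y + d X] diagonalises the system [X' = be Y], [Y' = - l Y - be X]. *)
Lemma small_root (r e S b : R) :
  0 <= r -> 0 <= e -> 0 <= S -> 0 < b -> b * e <= 4^-1 ->
  let be := b * e * r in let l := r + S in
  exists d, [/\ 0 <= d, d <= 2 * (b * e) & be * d ^+ 2 - l * d + be = 0].
Proof.
move=> r0 e0 S0 b0 be4 be l.
have be0 : 0 <= be by rewrite /be !mulr_ge0// ltW.
pose q := Num.sqrt (l ^+ 2 - 4 * be ^+ 2).
have ber : be <= 4^-1 * r by rewrite /be ler_wpM2r.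
have q2 : q ^+ 2 = l ^+ 2 - 4 * be ^+ 2 by rewrite sqr_sqrtr// /l; nra.
have q0 : 0 <= q := sqrtr_ge0 _.
move: r0; rewrite le_eqVlt => /orP[/eqP r0|r0].
  (* For [r = 0] the coupling vanishes, but [l + q] may vanish too; the root is then 0. *)
  have bee : be = 0 by rewrite /be -r0 mulr0.
  exists 0; split=> //; first by rewrite !mulr_ge0// ltW.
  by rewrite bee expr0n/= !mulr0 subr0 addr0.
have lq : 0 < l + q by rewrite /l; lra.
(* The root [(l - q) / (2 be)] in rationalised form: it makes sense for [be = 0] as well and is
   visibly at most [2 be / r = 2 b e]. *)
exists (2 * be / (l + q)); split.
- by rewrite divr_ge0 ?mulr_ge0// ltW.
- rewrite ler_pdivrMr// /l.
  have : 0 <= b * e by rewrite mulr_ge0// ltW.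
  have -> : be = b * e * r by [].
  nra.
- have -> : be * (2 * be / (l + q)) ^+ 2 - l * (2 * be / (l + q)) + be =
     be * (4 * be ^+ 2 - l ^+ 2 + q ^+ 2) / (l + q) ^+ 2.
    by field; rewrite gt_eqF.
  by rewrite q2; ring.
Qed.

End TwoModes.

(** * Comparison of the exact and the reference modes *)

Section TwoModeEstimate.
Context {R : realType}.
Implicit Types (r e S b d : R).

(** The exact decay rates [p] and [l - p] have product [be ^ 2 = mu * r]. Hence
    [(p - mu) * (l - p) = mu * (p - S)], where [l - p] is at least [7/8 r] while [p] and [S] are of
    order [e * r]: the relative error of [mu] is of order [e]. *)
Lemma root_slow r e S b d (be := b * e * r) (l := r + S)
    (mu := b ^+ 2 * e ^+ 2 * r) (p := be * d) :
  0 <= r -> 0 <= e -> e <= 1 -> 0 <= S -> S <= e * r -> 0 < b ->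
  b * e <= 4^-1 -> 0 <= d -> d <= 2 * (b * e) ->
  be * d ^+ 2 - l * d + be = 0 ->
  [/\ mu <= r / 16, mu / 2 <= p, p <= r / 8 & `|p - mu| <= mu * (e * (b + 2))].
Proof.
move=> r0 e0 e1 S0 Sr b0 be4 d0 dbe qd.
have x0 : 0 <= b * e by rewrite mulr_ge0// ltW.
have x2 : (b * e) ^+ 2 <= 16^-1 by nra.
have muE : mu = (b * e) ^+ 2 * r by rewrite /mu; ring.
have mu0 : 0 <= mu by rewrite muE mulr_ge0// sqr_ge0.
have mur : mu <= r / 16 by rewrite muE mulrC ler_wpM2l.
have p2 : p <= 2 * mu.
  have -> : p = b * e * r * d by [].
  have -> : 2 * mu = b * e * r * (2 * (b * e)) by rewrite muE; ring.
  by rewrite ler_wpM2l// mulr_ge0.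
have p0 : 0 <= p by rewrite !mulr_ge0// ltW.
have pl : p * (l - p) = mu * r.
  have : be * (be * d ^+ 2 - l * d + be) = 0 by rewrite qd mulr0.
  by rewrite /p muE /be; lra.
have [r00|rp] := eqVneq r 0.
  have S00 : S = 0 by apply/le_anti; rewrite S0 andbT; move: Sr; rewrite r00 mulr0.
  have m00 : mu = 0 by rewrite muE r00 mulr0.
  have p00 : p = 0 by rewrite /p /be r00 mulr0 mul0r.
  by split; rewrite ?m00 ?p00 ?r00 ?mul0r ?subrr ?normr0.
have {}rp : 0 < r by rewrite lt_neqAle eq_sym rp.
have Sr1 : S <= r by apply: (le_trans Sr); rewrite -[leRHS]mul1r ler_wpM2r// ltW.
split=> //.
- rewrite -(ler_pM2r rp).
  have : mu * r <= p * l by rewrite -pl ler_wpM2l// lerBlDr lerDl.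
  have : p * l <= p * (2 * r) by rewrite ler_wpM2l// /l; lra.
  lra.
- lra.
- have k1 : (p - mu) * (l - p) = mu * (p - S).
    by rewrite mulrBl pl /l; ring.
  have lp : 7 / 8 * r <= l - p by rewrite /l; lra.
  have lp0 : 0 < l - p by lra.
  have k2 : `|p - mu| * (l - p) = mu * `|p - S|.
    by rewrite -(gtr0_norm lp0) -normrM k1 normrM (ger0_norm mu0).
  have k3 : `|p - S| <= e * r * (b / 2 + 1).
    rewrite ler_norml; apply/andP; split.
      have : 0 <= e * r * (b / 2) by rewrite !mulr_ge0// ?invr_ge0// ltW.
      by lra.
    have : 2 * mu <= e * r * (b / 2).
      have -> : 2 * mu = (b * e) * (2 * b * e * r) by rewrite muE; ring.
      apply: (@le_trans _ _ (4^-1 * (2 * b * e * r))).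
        by rewrite ler_wpM2r// !mulr_ge0// ltW.
      by lra.
    lra.
  rewrite -(ler_pM2r lp0) k2 -[leRHS]mulrA ler_wpM2l//.
  apply: (le_trans k3).
  apply: (@le_trans _ _ (e * (b + 2) * (7 / 8 * r))); last first.
    by rewrite ler_wpM2l// mulr_ge0// addr_ge0// ltW.
  have : 0 <= e * r * b by rewrite !mulr_ge0// ltW.
  have : 0 <= e * r by rewrite !mulr_ge0.
  lra.
Qed.

(* [x] is one of the unknowns, recovered from the decoupled modes [x0 + d y0] and
   [y0 + d x0] by inverting the change of unknowns, of determinant [1 - d^2]. *)
Lemma combine_modes (x0 y0 d e k E1 E2 E3 E : R) (x : R) :
  0 <= d -> d <= 2^-1 -> d <= e * k -> 0 <= e -> 0 <= k ->
  0 <= E1 <= E -> 0 <= E2 <= E -> 0 <= E3 <= E ->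
  `|E1 - E2| <= e * k * E ->
  (1 - d ^+ 2) * x = (x0 + d * y0) * E1 - d * (y0 + d * x0) * E3 ->
  `|x - x0 * E2| <= 6 * (e * k) * E * (`|x0| + `|y0|).
Proof.
move=> d0 d2 dk e0 k0 /andP[E10 E1E] /andP[E20 E2E] /andP[E30 E3E] E12 xE.
have d34 : 3 / 4 <= 1 - d ^+ 2 by nra.
have dd : d ^+ 2 <= d / 2 by rewrite expr2; nra.
(* Every coefficient contains [E1 - E2] or a factor [d], both of order [e * k], and [1 - d ^ 2] is
   at least [3/4]. *)
have key : (1 - d ^+ 2) * (x - x0 * E2) =
   x0 * (E1 - E2 + d ^+ 2 * (E2 - E3)) + y0 * (d * (E1 - E3)).
  rewrite mulrBr xE; ring.
have E0 : 0 <= E by lra.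
have ekE : 0 <= e * k * E by rewrite !mulr_ge0.
have dE : d * E <= e * k * E by rewrite ler_wpM2r.
have nx0 := normr_ge0 x0; have ny0 := normr_ge0 y0.
have b1 : `|E1 - E2 + d ^+ 2 * (E2 - E3)| <= 2 * (e * k * E).
  apply: (le_trans (ler_normD _ _)); rewrite normrM ger0_norm ?sqr_ge0//.
  have : `|E2 - E3| <= E by rewrite ler_norml; lra.
  have := normr_ge0 (E2 - E3).
  nra.
have b2 : `|d * (E1 - E3)| <= 2 * (e * k * E).
  rewrite normrM ger0_norm//.
  have : `|E1 - E3| <= E by rewrite ler_norml; lra.
  have := normr_ge0 (E1 - E3).
  nra.
have : (1 - d ^+ 2) * `|x - x0 * E2| <= 2 * (e * k * E) * (`|x0| + `|y0|).
  rewrite -{1}(@ger0_norm _ (1 - d ^+ 2)); last lra.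
  rewrite -normrM key.
  apply: (le_trans (ler_normD _ _)).
  rewrite (normrM x0) (normrM y0) [leRHS]mulrDr.
  by apply: lerD; rewrite mulrC ler_wpM2r.
have : 0 <= e * k * E * (`|x0| + `|y0|) by rewrite mulr_ge0// addr_ge0.
have := normr_ge0 (x - x0 * E2).
nra.
Qed.

(* Used with [r = |xi|^(2 rho)], [e = |xi|^(1 - 2 rho)], [S = |xi|^(2 theta)], so
   that [be = b |xi|] and [mu = b^2 |xi|^(2 - 2 rho)]; this form needs no case
   distinction at [xi = 0]. *)
Lemma two_mode_estimate (r e S b nu : R) (X Y X' Y' : R -> R) (x0 y0 t : R)
    (be := b * e * r) (l := r + S) (mu := b ^+ 2 * e ^+ 2 * r) :
  0 <= r -> 0 <= e -> e <= 1 -> 0 <= S -> S <= e * r -> 0 < b ->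
  b * e <= 4^-1 -> r - mu <= nu -> nu <= l - mu ->
  X u @[u --> 0^'+] --> x0 -> Y u @[u --> 0^'+] --> y0 ->
  X' u @[u --> 0^'+] --> x0 -> Y' u @[u --> 0^'+] --> y0 ->
  (forall u : R, 0 < u -> is_derive u 1 X (be * Y u)) ->
  (forall u : R, 0 < u -> is_derive u 1 Y (- (l * Y u) - be * X u)) ->
  (forall u : R, 0 < u -> is_derive u 1 X' (- (mu * X' u))) ->
  (forall u : R, 0 < u -> is_derive u 1 Y' (- (nu * Y' u))) ->
  0 < t ->
  `|X t - X' t| <= 24 * (b + 3) * e * expR (- (mu * t / 4)) * (`|x0| + `|y0|) /\
  `|Y t - Y' t| <= 24 * (b + 3) * e * expR (- (mu * t / 4)) * (`|x0| + `|y0|).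
Proof.
move=> r0 e0 e1 S0 Sr b0 be4 nu1 nu2 X0 Y0 X0' Y0' dX dY dX' dY' t0.
have [d [d0 dbe qd]] := small_root r0 e0 S0 b0 be4.
have [mur mup pr pmu] := root_slow r0 e0 e1 S0 Sr b0 be4 d0 dbe qd.
rewrite -/be -/l -/mu in mur mup pr pmu qd.
set p := be * d in mup pr pmu.
have mu0 : 0 <= mu by rewrite /mu -exprMn mulr_ge0// sqr_ge0.
have cvgX c (f g : R -> R) (f0 g0 : R) : f u @[u --> 0^'+] --> f0 ->
    g u @[u --> 0^'+] --> g0 -> f u + c * g u @[u --> 0^'+] --> f0 + c * g0.
  by move=> cf cg; apply: cvgD => //; exact: cvgMr.
(* The quadratic equation for [d] cancels the remaining [Y] term, which leaves a scalar mode of rate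
   [p]. *)
have s1 : X t + d * Y t = (x0 + d * y0) * expR (- (p * t)).
  apply: (@decay_ode R (fun u => X u + d * Y u) p) => //.
    exact: cvgX.
  move=> u u0; have := dX u u0; have := dY u u0 => dYu dXu.
  apply: is_derive_eq; rewrite /GRing.scale/=.
  have : (be * d ^+ 2 - l * d + be) * Y u = 0 by rewrite qd mul0r.
  by rewrite /p; lra.
have s3 : Y t + d * X t = (y0 + d * x0) * expR (- ((l - p) * t)).
  apply: (@decay_ode R (fun u => Y u + d * X u) (l - p)) => //.
    exact: cvgX.
  move=> u u0; have := dX u u0; have := dY u u0 => dYu dXu.
  apply: is_derive_eq; rewrite /GRing.scale/=.
  have : (be * d ^+ 2 - l * d + be) * X u = 0 by rewrite qd mul0r.
  by rewrite /p; lra.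
have s1' : X' t = x0 * expR (- (mu * t)) by exact: decay_ode.
have s3' : Y' t = y0 * expR (- (nu * t)) by exact: decay_ode.
(* One half of the rate is lost in [p >= mu / 2], and one half of the rest in absorbing the factor
   [t]. *)
set E := expR (- (mu * t / 4)).
have k0 : 0 <= 4 * (b + 3) by rewrite mulr_ge0// addr_ge0// ltW.
have mut : 0 <= mu * t by rewrite mulr_ge0// ltW.
have exE z : mu * t / 4 <= z -> 0 <= expR (- z) <= E.
  by move=> h; rewrite expR_ge0 ler_expR; lra.
have rt : mu * t <= r / 16 * t by rewrite ler_pM2r.
have rt0 : 0 <= r * t by rewrite mulr_ge0// ltW.
have pt : mu / 2 * t <= p * t by rewrite ler_pM2r.
have lpr : 7 / 8 * r <= l - p by rewrite /l; lra.
have lpt : 7 / 8 * r * t <= (l - p) * t by rewrite ler_pM2r.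
have nur : 7 / 8 * r <= nu by lra.
have nut : 7 / 8 * r * t <= nu * t by rewrite ler_pM2r.
have be0 : 0 <= b * e by rewrite mulr_ge0// ltW.
have dk : d <= e * (4 * (b + 3)) by lra.
have d2 : d <= 2^-1 by lra.
have e1b : 0 <= e * (b + 2) by rewrite mulr_ge0// addr_ge0// ltW.
have E13 : `|expR (- (p * t)) - expR (- (mu * t))| <= e * (4 * (b + 3)) * E.
  apply: (@le_trans _ _ (e * (4 * (b + 2)) * E)); last first.
    rewrite ler_wpM2r ?expR_ge0// ler_wpM2l//; lra.
  apply: (le_trans (@normB_expRN_le _ _ _ (mu * t / 2) _ _)); [lra|lra|].
  rewrite -mulrBl normrM (gtr0_norm t0).
  apply: (@le_trans _ _ (mu * (e * (b + 2)) * t * expR (- (mu * t / 2)))).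
    by rewrite ler_wpM2r ?expR_ge0// ler_wpM2r// ltW.
  have -> : mu * (e * (b + 2)) * t * expR (- (mu * t / 2)) =
     e * (b + 2) * (mu * t * expR (- (mu * t / 2))) by ring.
  have -> : e * (4 * (b + 2)) * E = e * (b + 2) * (4 * E) by ring.
  by rewrite ler_wpM2l// mul_expRN_le.
have E33 : `|expR (- ((l - p) * t)) - expR (- (nu * t))| <=
    e * (4 * (b + 3)) * E.
  apply: (le_trans (@normB_expRN_le _ _ _ (r * t / 2) _ _)); [lra|lra|].
  rewrite -mulrBl normrM (gtr0_norm t0).
  (* [l - p - nu] lies between [mu - p] and [mu - p + S], so the freedom left to [nu] costs only
     [S <= e * r]. *)
  have h : `|l - p - nu| <= e * (b + 3) * r.
    have := pmu; rewrite ler_norml => /andP[h1 h2].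
    have : mu * (e * (b + 2)) <= r * (e * (b + 2)) by rewrite ler_wpM2r//; lra.
    have := mulr_ge0 e1b r0.
    have := mulr_ge0 e0 r0.
    by rewrite ler_norml; rewrite /l in nu2 *; lra.
  apply: (@le_trans _ _ (e * (b + 3) * r * t * expR (- (r * t / 2)))).
    by rewrite ler_wpM2r ?expR_ge0// ler_wpM2r// ltW.
  have -> : e * (b + 3) * r * t * expR (- (r * t / 2)) =
     e * (b + 3) * (r * t * expR (- (r * t / 2))) by ring.
  have -> : e * (4 * (b + 3)) * E = e * (b + 3) * (4 * E) by ring.
  have eb3 : 0 <= e * (b + 3) by rewrite mulr_ge0// addr_ge0// ltW.
  rewrite ler_wpM2l//; apply: (le_trans (mul_expRN_le _)).
  by rewrite ler_wpM2l// ler_expR; lra.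
have I1 : 0 <= expR (- (p * t)) <= E by apply: exE; lra.
have I2 : 0 <= expR (- (mu * t)) <= E by apply: exE; lra.
have I3 : 0 <= expR (- ((l - p) * t)) <= E by apply: exE; lra.
have I4 : 0 <= expR (- (nu * t)) <= E by apply: exE; lra.
have -> : 24 * (b + 3) * e = 6 * (e * (4 * (b + 3))) by ring.
rewrite s1' s3'; split.
  apply: (combine_modes d0 d2 dk e0 k0 I1 I2 I3 E13).
  by rewrite -mulrA -s3 -s1; ring.
rewrite [`|x0| + _]addrC.
apply: (combine_modes d0 d2 dk e0 k0 I3 I4 I1 E33).
by rewrite -mulrA -s3 -s1; ring.
Qed.

End TwoModeEstimate.

(** * Fubini's theorem for bounded kernels *)

Section SwapKernel.
Context d {R : realType} {T : measurableType d}.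
Variable mu : {sigma_finite_measure set T -> \bar R}.
Local Open Scope ereal_scope.

Lemma integrable_prod_kernel (g h : T -> R) (c : T * T -> R) :
  mu.-integrable setT (EFin \o g) -> mu.-integrable setT (EFin \o h) ->
  measurable_fun setT c -> (forall z, `|c z| <= 1)%R ->
  (mu \x mu).-integrable setT (fun z => (g z.1 * h z.2 * c z)%:E).
Proof.
move=> ig ih mc c1.
have mg : measurable_fun setT g by apply/measurable_EFinP/(measurable_int _ ig).
have mh : measurable_fun setT h by apply/measurable_EFinP/(measurable_int _ ih).
have mgh : measurable_fun setT (fun z : T * T => (g z.1 * h z.2 * c z)%:E).
  apply/measurable_EFinP; apply: measurable_funM => //; apply: measurable_funM.
    exact: measurableT_comp.
  exact: measurableT_comp.
apply: (integrable12ltyP mu mu mgh).2.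
have /integrableP[_ hoo] := ih.
set H := \int[mu]_y `|(h y)%:E|.
have H0 : 0 <= H by exact: integral_ge0.
have [H' HE] : exists H', H = H'%:E.
  by exists (fine H); rewrite fineK// ge0_fin_numE.
have H'0 : (0 <= H')%R by rewrite -lee_fin -HE.
apply: (@le_lt_trans _ _ (\int[mu]_x (H'%:E * `|(g x)%:E|))).
  apply: ge0_le_integral => //.
  - by move=> x _; exact: integral_ge0.
  - apply: (measurable_fun_fubini_tonelli_F (fun z : T * T => `|(g z.1 * h z.2 * c z)%:E|)) => //.
    exact: measurableT_comp.
  - by apply: measurable_funeM; apply: measurableT_comp => //; exact/measurable_EFinP.
  - move=> x _ /=.
    rewrite -HE muleC -ge0_integralZl//; last first.
      by apply: measurableT_comp => //; exact/measurable_EFinP.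
    apply: ge0_le_integral => //.
    + apply: measurableT_comp => //.
      apply: measurableT_comp => //; apply/measurable_EFinP.
      exact: (measurableT_comp mgh (pair1_measurable x)).
    + by apply: measurable_funeM; apply: measurableT_comp => //; exact/measurable_EFinP.
    + move=> y _ /=.
      by rewrite -EFinM lee_fin !normrM -[leRHS]mulr1 ler_wpM2l// mulr_ge0.
rewrite ge0_integralZl//.
- apply: lte_mul_pinfty => //.
  by have /integrableP[] := ig.
- by apply: measurableT_comp => //; exact/measurable_EFinP.
Qed.

(** Tonelli's theorem applies to the positive and negative parts. As [fine] is measurable, sections
    without a finite integral are covered by its default value. *)
Lemma measurable_Rintegral_pair d' (T' : measurableType d') (p : T' * T -> R) :
  measurable_fun setT p ->
  measurable_fun setT (fun x => \int[mu]_y p (x, y))%R.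
Proof.
move=> mp.
have mp' : measurable_fun setT (EFin \o p) by exact/measurable_EFinP.
suff: measurable_fun setT (fun x => \int[mu]_y (p (x, y))%:E) by exact: measurableT_comp.
have -> : (fun x => \int[mu]_y (p (x, y))%:E) =
    (fun x => \int[mu]_y ((EFin \o p)^\+ (x, y)) - \int[mu]_y ((EFin \o p)^\- (x, y))).
  apply/funext => x; rewrite integralE.
  by congr (_ - _); apply: eq_integral => y _; rewrite ?funeposE ?funenegE.
apply: emeasurable_funB.
  apply: (measurable_fun_fubini_tonelli_F (EFin \o p)^\+) => //.
  exact: measurable_funepos.
apply: (measurable_fun_fubini_tonelli_F (EFin \o p)^\-) => //.
exact: measurable_funeneg.
Qed.

Lemma integrable_kernel (h c : T -> R) :
  mu.-integrable setT (EFin \o h) -> measurable_fun setT c ->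
  (forall z, `|c z| <= 1)%R ->
  mu.-integrable setT (EFin \o (fun y => h y * c y)%R).
Proof.
move=> ih mc c1.
have mh : measurable_fun setT h by apply/measurable_EFinP/(measurable_int _ ih).
apply: (le_integrable measurableT) ih => //.
  by apply/measurable_EFinP; exact: measurable_funM.
by move=> y _ /=; rewrite lee_fin normrM -[leRHS]mulr1 ler_wpM2l.
Qed.

(** The multiplication formula for a transform with bounded kernel: both sides are iterated
    integrals of [g x * h y * c (x, y)], which is integrable for the product measure. *)
Lemma Rintegral_kernel_swap (g h : T -> R) (c : T * T -> R) :
  mu.-integrable setT (EFin \o g) -> mu.-integrable setT (EFin \o h) ->
  measurable_fun setT c -> (forall z, `|c z| <= 1)%R ->
  \int[mu]_x (g x * \int[mu]_y (h y * c (x, y)))%:E =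
  \int[mu]_y (h y * \int[mu]_x (g x * c (x, y)))%:E.
Proof.
move=> ig ih mc c1.
have mc1 x : measurable_fun setT (fun y => c (x, y)).
  exact: (measurableT_comp mc (pair1_measurable x)).
have mc2 y : measurable_fun setT (fun x => c (x, y)).
  exact: (measurableT_comp mc (pair2_measurable y)).
transitivity (\int[mu]_x \int[mu]_y (g x * h y * c (x, y))%:E).
  apply: eq_integral => x _.
  under [RHS]eq_integral do rewrite -mulrA EFinM.
  have ihc : mu.-integrable setT (EFin \o (fun y => h y * c (x, y))%R).
    exact: integrable_kernel.
  rewrite integralZl// EFinM; congr (_ * _).
  by rewrite fineK//; exact: integrable_fin_num.
rewrite (Fubini (integrable_prod_kernel ig ih mc c1)).
apply: eq_integral => y _ /=.
under eq_integral do rewrite (mulrC (g _)) -mulrA EFinM.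
have igc : mu.-integrable setT (EFin \o (fun x => g x * c (x, y))%R).
  exact: integrable_kernel.
rewrite integralZl// EFinM; congr (_ * _).
by rewrite fineK//; exact: integrable_fin_num.
Qed.

Lemma norm_Rintegral_kernel (h c : T -> R) :
  mu.-integrable setT (EFin \o h) -> measurable_fun setT c ->
  (forall z, `|c z| <= 1)%R ->
  (`| \int[mu]_y (h y * c y) |%R <= \int[mu]_y `|h y|)%R.
Proof.
move=> ih mc c1.
have ihc := integrable_kernel ih mc c1.
apply: (le_trans (le_normr_Rintegral measurableT ihc)).
apply: le_Rintegral => //.
- exact: (integrable_norm ihc).
- exact: (integrable_norm ih).
- by move=> y _; rewrite normrM -[leRHS]mulr1 ler_wpM2l.
Qed.

End SwapKernel.

(** * Schur's test and weighted L^2 bounds *)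

Section TTstar.
Context d {R : realType} {T : measurableType d}.
Variable mu : {sigma_finite_measure set T -> \bar R}.
Local Open Scope ereal_scope.

(** Both integrals may be infinite. If that of [h] is, its real value is 0 by the convention of
    [fine] and the bound is trivial. *)
Lemma le_norm_Rintegral (h : T -> R) (k : T -> R) :
  measurable_fun setT h -> measurable_fun setT k ->
  (forall x, `|h x| <= k x)%R ->
  (`| \int[mu]_y (h y) |%R)%:E <= \int[mu]_y (k y)%:E.
Proof.
move=> mh mk hk.
apply: (@le_trans _ _ `| \int[mu]_y (h y)%:E |).
  by rewrite /Rintegral; case: (\int[mu]_y (h y)%:E) => [r| |]//=; rewrite normr0 leey.
have mh' : measurable_fun setT (EFin \o h) by exact/measurable_EFinP.
apply: (le_trans (le_abse_integral mu measurableT mh')).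
apply: ge0_le_integral => //.
- exact: measurableT_comp.
- exact/measurable_EFinP.
- by move=> x _; rewrite lee_fin.
Qed.

(** Schur's test by [2 |f x| |f y| <= f x ^ 2 + f y ^ 2]: each square is integrated against the
    marginal of [k] in the other variable. *)
Lemma schur_quadratic (f : T -> R) (k : T * T -> R) (M : R) :
  measurable_fun setT f -> measurable_fun setT k ->
  (forall z, 0 <= k z)%R ->
  (forall x, \int[mu]_y (k (x, y))%:E <= M%:E) ->
  (forall y, \int[mu]_x (k (x, y))%:E <= M%:E) ->
  \int[mu]_x \int[mu]_y (`|f x| * `|f y| * k (x, y))%:E
    <= M%:E * \int[mu]_x (f x ^+ 2)%:E.
Proof.
move=> mf mk k0 kM1 kM2.
have mfst : measurable_fun setT (fun z : T * T => (f z.1 ^+ 2 * k z)%:E).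
  apply/measurable_EFinP; apply: measurable_funM => //; apply: measurable_funX.
  exact: measurableT_comp.
have msnd : measurable_fun setT (fun z : T * T => (f z.2 ^+ 2 * k z)%:E).
  apply/measurable_EFinP; apply: measurable_funM => //; apply: measurable_funX.
  exact: measurableT_comp.
have mabs : measurable_fun setT (fun z : T * T => (`|f z.1| * `|f z.2| * k z)%:E).
  apply/measurable_EFinP; apply: measurable_funM => //; apply: measurable_funM.
    by apply: measurableT_comp => //; exact: measurableT_comp.
  by apply: measurableT_comp => //; exact: measurableT_comp.
have mk1 x : measurable_fun setT (fun y => (k (x, y))%:E).
  exact/measurable_EFinP/(measurableT_comp mk (pair1_measurable x)).
have mk2 y : measurable_fun setT (fun x => (k (x, y))%:E).
  exact/measurable_EFinP/(measurableT_comp mk (pair2_measurable y)).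
have mf2 : measurable_fun setT (fun x => (f x ^+ 2)%:E).
  by apply/measurable_EFinP; exact: measurable_funX.
have fst0 z : 0 <= (f z.1 ^+ 2 * k z)%:E by rewrite lee_fin mulr_ge0// sqr_ge0.
have snd0 z : 0 <= (f z.2 ^+ 2 * k z)%:E by rewrite lee_fin mulr_ge0// sqr_ge0.
have f20 x : 0 <= (f x ^+ 2)%:E by rewrite lee_fin sqr_ge0.
have M0 : 0 <= M%:E :> \bar R.
  apply: le_trans (kM1 point).
  by apply: integral_ge0 => y _; rewrite lee_fin.
have b1 : \int[mu \x mu]_z (f z.1 ^+ 2 * k z)%:E <= M%:E * \int[mu]_x (f x ^+ 2)%:E.
  rewrite fubini_tonelli1// -ge0_integralZl//.
  apply: ge0_le_integral => //.
  - by move=> x _; apply: integral_ge0.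
  - exact: measurable_fun_fubini_tonelli_F.
  - exact: measurable_funeM.
  - move=> x _; rewrite /fubini_F /=.
    under eq_integral do rewrite EFinM.
    rewrite ge0_integralZl//; last by move=> y _; rewrite lee_fin.
    by rewrite muleC lee_wpmul2r.
have b2 : \int[mu \x mu]_z (f z.2 ^+ 2 * k z)%:E <= M%:E * \int[mu]_x (f x ^+ 2)%:E.
  rewrite fubini_tonelli2// -ge0_integralZl//.
  apply: ge0_le_integral => //.
  - by move=> x _; apply: integral_ge0.
  - exact: measurable_fun_fubini_tonelli_G.
  - exact: measurable_funeM.
  - move=> x _; rewrite /fubini_G /=.
    under eq_integral do rewrite EFinM.
    rewrite ge0_integralZl//; last by move=> y _; rewrite lee_fin.
    by rewrite muleC lee_wpmul2r.
rewrite -(fubini_tonelli1 (fun z : T * T => (`|f z.1| * `|f z.2| * k z)%:E))//; last first.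
  by move=> z; rewrite lee_fin !mulr_ge0.
apply: (@le_trans _ _ (\int[mu \x mu]_z
    ((2^-1)%:E * ((f z.1 ^+ 2 * k z)%:E + (f z.2 ^+ 2 * k z)%:E)))).
  apply: ge0_le_integral => //.
  - by move=> z _; rewrite lee_fin !mulr_ge0.
  - by apply: measurable_funeM; exact: emeasurable_funD.
  - move=> z _; rewrite -EFinD -EFinM lee_fin -mulrDl mulrA ler_wpM2r//.
    have := sqr_ge0 (`|f z.1| - `|f z.2|)%R.
    rewrite sqrrB !real_normK ?num_real//; lra.
rewrite ge0_integralZl//; last first.
- by move=> z _; rewrite adde_ge0.
- exact: emeasurable_funD.
rewrite ge0_integralD//.
apply: (@le_trans _ _ ((2^-1)%:E * (M%:E * \int[mu]_x (f x ^+ 2)%:E +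
   M%:E * \int[mu]_x (f x ^+ 2)%:E))).
  by rewrite lee_wpmul2l ?lee_fin// leeD.
rewrite -ge0_muleDr//; last 2 first.
- exact: integral_ge0.
- exact: integral_ge0.
rewrite muleCA lee_wpmul2l//.
have : 0 <= \int[mu]_x (f x ^+ 2)%:E by exact: integral_ge0.
case: (\int[mu]_x (f x ^+ 2)%:E) => [r| |]//= _; last by rewrite leey.
by rewrite -EFinD -EFinM lee_fin; lra.
Qed.

(* The TT* argument: the square of the transform is expanded into a quadratic form
   whose kernel is the transform of the weight, to which the Schur test applies. *)
Lemma tt_star (f psi : T -> R) (e k : T * T -> R) (M : R) :
  mu.-integrable setT (EFin \o f) -> mu.-integrable setT (EFin \o psi) ->
  (forall z, 0 <= psi z)%R ->
  measurable_fun setT e -> (forall z, `|e z| <= 1)%R ->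
  measurable_fun setT k -> (forall z, 0 <= k z)%R ->
  (forall x, \int[mu]_y (k (x, y))%:E <= M%:E) ->
  (forall y, \int[mu]_x (k (x, y))%:E <= M%:E) ->
  (forall x y, `|\int[mu]_z (psi z * e (x, z) * e (y, z)) | <= k (x, y))%R ->
  \int[mu]_z (psi z * (\int[mu]_x (f x * e (x, z))) ^+ 2)%:E
    <= M%:E * \int[mu]_x (f x ^+ 2)%:E.
Proof.
move=> intf ipsi psi0 me e1 mk k0 kM1 kM2 ek.
have mf : measurable_fun setT f by apply/measurable_EFinP/(measurable_int _ intf).
have mpsi : measurable_fun setT psi.
  by apply/measurable_EFinP/(measurable_int _ ipsi).
have me1 x : measurable_fun setT (fun z => e (x, z)).
  exact: (measurableT_comp me (pair1_measurable x)).
have me2 z : measurable_fun setT (fun x => e (x, z)).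
  exact: (measurableT_comp me (pair2_measurable z)).
have mswap : measurable_fun setT (fun z : T * T => e (z.2, z.1)).
  by apply: (measurableT_comp me); exact: measurable_swap.
pose F z := (\int[mu]_x (f x * e (x, z)))%R.
have mF : measurable_fun setT F.
  apply: (@measurable_Rintegral_pair _ _ _ mu _ _ (fun u => f u.2 * e (u.2, u.1)))%R.
  apply: measurable_funM => //; exact: measurableT_comp.
pose A := (\int[mu]_x `|f x|)%R.
have A0 : (0 <= A)%R by exact: Rintegral_ge0.
have FA z : (`|F z| <= A)%R by exact: norm_Rintegral_kernel.
(* The transform [F] is bounded because [f] is integrable; so [psi * F] is integrable and the first
   exchange below is legitimate. *)
have ipF : mu.-integrable setT (EFin \o (fun z => psi z * F z)%R).
  apply: (le_integrable measurableT) (integrableZl measurableT A ipsi) => //.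
    by apply/measurable_EFinP; exact: measurable_funM.
  move=> z _ /=; rewrite lee_fin normrM [leRHS]normrM mulrC (ger0_norm A0).
  by rewrite ler_wpM2r.
have swap1 : \int[mu]_z (psi z * F z ^+ 2)%:E =
    \int[mu]_x (f x * \int[mu]_z (psi z * F z * e (x, z)))%:E.
  rewrite (Rintegral_kernel_swap intf ipF me e1).
  by apply: eq_integral => z _; rewrite expr2 mulrA.
have swap2 x : (\int[mu]_z (psi z * F z * e (x, z)) =
    \int[mu]_y (f y * \int[mu]_z (psi z * e (x, z) * e (y, z))))%R.
  have ipe : mu.-integrable setT (EFin \o (fun z => psi z * e (x, z))%R).
    exact: integrable_kernel.
  rewrite /Rintegral (Rintegral_kernel_swap intf ipe me e1); congr fine.
  by apply: eq_integral => z _; rewrite mulrAC.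
(* The kernel left once both factors [F] are expanded. For cosines and sines it combines values of
   the transform of [psi] at [x - y] and [x + y]. *)
pose kap (x y : T) := (\int[mu]_z (psi z * e (x, z) * e (y, z)))%R.
have mkap x : measurable_fun setT (fun y => f y * kap x y)%R.
  apply: measurable_funM => //.
  apply: (@measurable_Rintegral_pair _ _ _ mu _ _ (fun u => psi u.2 * e (x, u.2) * e u))%R.
  apply: measurable_funM => //; apply: measurable_funM => //.
    exact: measurableT_comp.
  exact: (measurableT_comp (me1 x)).
have mk1 x : measurable_fun setT (fun y => k (x, y)).
  exact: (measurableT_comp mk (pair1_measurable x)).
have mabs : measurable_fun setT (fun z : T * T => (`|f z.1| * `|f z.2| * k z)%:E).
  apply/measurable_EFinP; apply: measurable_funM => //; apply: measurable_funM.
    by apply: measurableT_comp => //; exact: measurableT_comp.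
  by apply: measurableT_comp => //; exact: measurableT_comp.
have mH : measurable_fun setT
    (fun x => f x * \int[mu]_z (psi z * F z * e (x, z)))%R.
  apply: measurable_funM => //.
  apply: (@measurable_Rintegral_pair _ _ _ mu _ _ (fun u => psi u.2 * F u.2 * e u))%R.
  apply: measurable_funM => //; apply: measurable_funM => //;
  exact: measurableT_comp.
apply: le_trans (schur_quadratic mf mk k0 kM1 kM2).
rewrite swap1; apply: (le_trans (lee_abs _)).
apply: le_trans; first by apply: le_abse_integral => //; exact/measurable_EFinP.
apply: ge0_le_integral => //.
- by apply: measurableT_comp => //; exact/measurable_EFinP.
- apply: (measurable_fun_fubini_tonelli_F (fun z : T * T => (`|f z.1| * `|f z.2| * k z)%:E)) => //.
  by move=> z; rewrite lee_fin !mulr_ge0.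
move=> x _; rewrite swap2 /= normrM EFinM.
have -> : \int[mu]_y (`|f x| * `|f y| * k (x, y))%:E =
    `|f x|%:E * \int[mu]_y (`|f y| * k (x, y))%:E.
  rewrite -ge0_integralZl//.
  - by apply: eq_integral => y _; rewrite -EFinM mulrA.
  - apply/measurable_EFinP; apply: measurable_funM => //.
    exact: measurableT_comp.
  - by move=> y _; rewrite lee_fin mulr_ge0.
apply: lee_wpmul2l; first by rewrite lee_fin.
apply: le_norm_Rintegral => //.
- exact: mkap.
- by apply: measurable_funM => //; exact: measurableT_comp.
- by move=> y; rewrite normrM ler_wpM2l// ek.
Qed.

End TTstar.

(** * Mass of the Cauchy kernel *)

Section CauchyKernel.
Context {R : realType}.
Local Notation mu := (@lebesgue_measure R).
Implicit Types (T x y z B u : R).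

Lemma integral_oneDsqrV :
  (\int[mu]_y ((oneDsqr y)^-1)%:E = pi%:E)%E.
Proof.
rewrite ge0_symfun_integralT.
- by rewrite -set_itvcy integral0y_oneDsqr -EFinM mulrC divfK.
- by move=> y; rewrite invr_ge0 (le_trans ler01)// oneDsqr_ge1.
- exact: continuous_oneDsqrV.
- by move=> y /=; rewrite /oneDsqr sqrrN.
Qed.

Lemma integral_cauchy T x : 0 < T ->
  (\int[mu]_y ((oneDsqr (T * (y - x)))^-1)%:E = (pi / T)%:E)%E.
Proof.
move=> T0; pose F (y : R) := T * (y - x).
have dF (y : R) : is_derive y (1 : R) F T.
  by apply: is_derive_eq; rewrite /GRing.scale/=; ring.
have F' : derive1 F = cst T by apply/funext => y; rewrite derive1E (@derive_val _ _ _ _ _ _ _ (dF y)).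
have cF : continuous F.
  by move=> y; apply: cvgMr; apply: cvgB; [exact: cvg_id|exact: cvg_cst].
have cG : continuous (fun y => (oneDsqr (T * (y - x)))^-1).
  move=> y; apply: (@continuous_comp _ _ _ F (fun y => (oneDsqr y)^-1)) => //.
    exact: cF.
  exact: continuous_oneDsqrV.
have : (\int[mu]_y (((fun y => (oneDsqr y)^-1) \o F) y * derive1 F y)%:E = pi%:E)%E.
  rewrite -increasing_ge0_integration_by_substitutionT ?integral_oneDsqrV//.
  - by move=> y z yz; rewrite /F ltr_pM2l// ltrD2r.
  - by rewrite F' => y; exact: cvg_cst.
  - by rewrite F'; exact: is_cvg_cst.
  - by rewrite F'; exact: is_cvg_cst.
  - apply/cvgrNyPle => A; near=> y.
    rewrite /F mulrC -ler_pdivlMr// lerBlDr.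
    by near: y; apply: nbhs_ninfty_le; rewrite num_real.
  - apply/cvgryPge => A; near=> y.
    rewrite /F mulrC -ler_pdivrMr// lerBrDr.
    by near: y; apply: nbhs_pinfty_ge; rewrite num_real.
  - exact: continuous_oneDsqrV.
rewrite F'; under eq_integral do rewrite /= mulrC EFinM.
rewrite ge0_integralZl_EFin//.
- move=> h; rewrite mulrC EFinM -h muleA -EFinM mulVf ?mul1e// gt_eqF//.
- by apply/measurable_EFinP; exact: continuous_measurable_fun.
- exact: ltW.
Unshelve. all: by end_near.
Qed.

End CauchyKernel.

(** * A compactly supported weight with explicit transform *)

Section HatFourier.
Context {R : realType}.
Local Notation mu := (@lebesgue_measure R).
Implicit Types (z B : R).

(** A parabola truncated at its zeros: being continuous there, it has a transform of order
    [z ^ (-2)], hence integrable, and the transform is explicit. *)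
Definition hat (u : R) : R := Num.max 0 (1 - u ^+ 2).

Lemma hat_ge0 u : 0 <= hat u.
Proof. by rewrite /hat le_max lexx. Qed.

Lemma hat_patch (c : R -> R) :
  (fun u => (hat u * c u)%:E) =
  (fun u => ((1 - u ^+ 2) * c u)%:E) \_ `[-1, 1].
Proof.
apply/funext => u; rewrite patchE mem_setE in_itv/= /hat.
case: ifPn => [/andP[u1 u2]|].
  by rewrite max_r//; nra.
rewrite negb_and -!ltNge => /orP[u1|u1]; rewrite max_l ?mul0r//; nra.
Qed.

Lemma continuous_hat_poly_cos z B :
  continuous (fun u : R => (1 - u ^+ 2) * cos (z * u + B)).
Proof.
move=> u; apply: cvgM.
  by apply: cvgB; [exact: cvg_cst|exact: exprn_continuous].
apply: (@continuous_comp _ _ _ (fun u : R => z * u + B) cos).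
  by apply: cvgD; [apply: cvgMr; exact: cvg_id|exact: cvg_cst].
exact: continuous_cos.
Qed.

(** The phase [B] lets plane integrals be computed one variable at a time, the other variable
    entering as a phase. As [hat] is even, only the factor [cos B] survives. *)
Lemma integral_hat_cos z B : z != 0 ->
  (\int[mu]_u (hat u * cos (z * u + B))%:E =
    (cos B * (4 * (sin z - z * cos z) / z ^+ 3))%:E)%E.
Proof.
move=> z0.
(* Antiderivative from two integrations by parts; its first term vanishes at both end points. *)
pose F (u : R) := (1 - u ^+ 2) * sin (z * u + B) / z
  - 2 * u * cos (z * u + B) / z ^+ 2 + 2 * sin (z * u + B) / z ^+ 3.
have dl (u : R) : is_derive u 1 (fun u : R => z * u + B) z.
  by apply: is_derive_eq; rewrite /GRing.scale/=; ring.
have ds (u : R) : is_derive u 1 (fun u : R => sin (z * u + B)) (z * cos (z * u + B)).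
  apply: (@is_derive_eq _ _ _ _ _ _ _ _ (is_derive1_comp (is_derive_sin _) (dl u))).
  by rewrite mulrC.
have dc (u : R) : is_derive u 1 (fun u : R => cos (z * u + B)) (- z * sin (z * u + B)).
  apply: (@is_derive_eq _ _ _ _ _ _ _ _ (is_derive1_comp (is_derive_cos _) (dl u))).
  by ring.
have dF (u : R) : is_derive u 1 F ((1 - u ^+ 2) * cos (z * u + B)).
  apply: is_derive_eq; rewrite /GRing.scale/=.
  by field.
have cF : continuous F.
  by move=> u; apply/differentiable_continuous/derivable1_diffP; have [] := dF u.
rewrite hat_patch -integral_mkcond (@continuous_FTC2 _ _ F) //.
- rewrite -EFinB; congr EFin; rewrite /F.
  have -> : z * -1 + B = - (z - B) by ring.
  by rewrite !(mulr1, sinN, cosN, sinD, cosD); field.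
- exact/continuous_subspaceT/continuous_hat_poly_cos.
- split.
  + by move=> u _; have [] := dF u.
  + by apply: cvg_at_right_filter; exact: cF.
  + by apply: cvg_at_left_filter; exact: cF.
- by move=> u _; rewrite derive1E (@derive_val _ _ _ _ _ _ _ (dF u)).
Qed.

Lemma measurable_hat : measurable_fun setT hat.
Proof.
apply: measurable_maxr => //; apply: continuous_measurable_fun => u.
by apply: cvgB; [exact: cvg_cst|exact: exprn_continuous].
Qed.

Lemma integral_hat_le : (\int[mu]_u (hat u)%:E <= 2%:E)%E.
Proof.
have -> : (fun u => (hat u)%:E) = (fun u => (1 - u ^+ 2)%:E) \_ `[-1, 1].
  apply/funext => u; have := congr1 (fun f => f u) (hat_patch (cst 1)).
  by rewrite /= mulr1 => ->; rewrite !patchE mulr1.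
rewrite -integral_mkcond.
apply: (@le_trans _ _ (\int[mu]_(u in `[(-1)%R, 1%R]) (cst 1%:E u))%E).
  apply: ge0_le_integral => //.
  - by move=> u /=; rewrite in_itv/= lee_fin => /andP[u1 u2]; nra.
  - apply/measurable_EFinP; apply: measurable_funTS.
    apply: continuous_measurable_fun => u.
    by apply: cvgB; [exact: cvg_cst|exact: exprn_continuous].
  - by move=> u _; rewrite lee_fin; have := sqr_ge0 u; lra.
rewrite integral_cst//= mul1e lebesgue_measure_itv/= lte_fin.
by rewrite ifT -?EFinD ?lee_fin; lra.
Qed.

Lemma integrable_hat : mu.-integrable setT (EFin \o hat).
Proof.
apply/integrableP; split; first by apply/measurable_EFinP; exact: measurable_hat.
under eq_integral do rewrite /= ger0_norm ?hat_ge0//.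
by apply: (le_lt_trans integral_hat_le); rewrite ltry.
Qed.

Definition hat_fourier z : R := (\int[mu]_u (hat u * cos (z * u)))%R.

Lemma Rintegral_hat_cos z B :
  (\int[mu]_u (hat u * cos (z * u + B)))%R = cos B * hat_fourier z.
Proof.
have [->|z0] := eqVneq z 0.
  rewrite /hat_fourier mulrC -RintegralZr//; last first.
    have -> : (EFin \o (fun u : R => hat u * cos (0 * u))) = EFin \o hat.
      by apply/funext => u /=; rewrite mul0r cos0 mulr1.
    exact: integrable_hat.
  by apply: eq_Rintegral => u _; rewrite mul0r add0r cos0 mulr1.
rewrite /hat_fourier /Rintegral integral_hat_cos//=.
under eq_integral do rewrite -(addr0 (z * _)).
by rewrite integral_hat_cos//= cos0 mul1r.
Qed.

Lemma integrable_hat_cos z B :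
  mu.-integrable setT (EFin \o (fun u => hat u * cos (z * u + B))).
Proof.
apply: (le_integrable measurableT) integrable_hat => //.
  apply/measurable_EFinP; apply: measurable_funM; first exact: measurable_hat.
  apply: continuous_measurable_fun => u.
  apply: (@continuous_comp _ _ _ (fun u : R => z * u + B) cos).
    by apply: cvgD; [apply: cvgMr; exact: cvg_id|exact: cvg_cst].
  exact: continuous_cos.
move=> u _ /=; rewrite lee_fin normrM -[leRHS]mulr1 ler_wpM2l//.
by rewrite ler_norml cos_geN1 cos_le1.
Qed.

Lemma integral_hat_cosE z B :
  (\int[mu]_u (hat u * cos (z * u + B))%:E = (cos B * hat_fourier z)%:E)%E.
Proof.
rewrite -Rintegral_hat_cos fineK//.
by apply: integrable_fin_num => //; exact: integrable_hat_cos.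
Qed.

(** For [|z| <= 1] the mass of [hat] bounds the transform. For [|z| > 1] the closed formula is used
    with [|sin z - z cos z| <= 2 |z|] and [1 + z ^ 2 <= 2 z ^ 2], whence [16 = 4 * 2 * 2]. *)
Lemma hat_fourier_le z : `|hat_fourier z| <= 16 * (oneDsqr z)^-1.
Proof.
have d1 : 0 < oneDsqr z by rewrite /oneDsqr; have := sqr_ge0 z; lra.
rewrite ler_pdivlMr//.
have [z1|z1] := leP (`|z|) 1.
  have h2 : `|hat_fourier z| <= 2.
    have ih : mu.-integrable setT (EFin \o (fun u : R => hat u * cos (z * u))).
      by have := integrable_hat_cos z 0; under eq_fun do rewrite addr0.
    apply: (le_trans (le_normr_Rintegral measurableT ih)).
    rewrite -lee_fin; apply: le_trans integral_hat_le.
    rewrite fineK; last by apply: integrable_fin_num => //; exact: (integrable_norm ih).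
    apply: ge0_le_integral => //.
    - exact: (measurable_int _ (integrable_norm ih)).
    - by apply/measurable_EFinP; exact: measurable_hat.
    - move=> u _; rewrite lee_fin normrM ger0_norm ?hat_ge0//.
      rewrite -[leRHS]mulr1 ler_wpM2l ?hat_ge0//.
      by rewrite ler_norml cos_geN1 cos_le1.
  have : z ^+ 2 <= 1 by rewrite -real_normK ?num_real// expr_le1.
  have := normr_ge0 (hat_fourier z).
  by rewrite /oneDsqr; nra.
have z0 : z != 0 by rewrite -normr_gt0; lra.
rewrite /hat_fourier /Rintegral.
under eq_integral do rewrite -(addr0 (z * _)).
rewrite integral_hat_cos//= cos0 mul1r normrM normfV normrX normrM.
have z3 : 0 < `|z| ^+ 3 by rewrite exprn_gt0//; lra.
rewrite mulrAC ler_pdivrMr// (@ger0_norm _ 4)//.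
have h1 : `|sin z - z * cos z| <= 1 + `|z|.
  apply: (le_trans (ler_normB _ _)); apply: lerD.
    by rewrite ler_norml sin_geN1 sin_le1.
  rewrite normrM -[leRHS]mulr1 ler_wpM2l//.
  by rewrite ler_norml cos_geN1 cos_le1.
have -> : oneDsqr z = 1 + `|z| ^+ 2 by rewrite /oneDsqr real_normK ?num_real.
move: (`|sin z - _|) (normr_ge0 (sin z - z * cos z)) h1 => s s0 h1.
move: (`|z|) z1 h1 z3 => y y1 h1 y3.
have a1 : s <= 2 * y by lra.
have a2 : 1 + y ^+ 2 <= 2 * y ^+ 2 by nra.
have a3 : s * (1 + y ^+ 2) <= 2 * y * (2 * y ^+ 2).
  by apply: ler_pM => //; rewrite addr_ge0// sqr_ge0.

by lra.
Qed.

End HatFourier.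

(** * Plancherel's inequality on the support of the weight *)

Section LocalPlancherel.
Context {R : realType}.
Local Notation plane := (measurableTypeR R * measurableTypeR R)%type.
Implicit Types (T : R) (x y z : plane).

(* The canonical sigma-finite structure of a product measure is declared for
   products of probabilities only, hence this copy of [leb2]. *)
Definition area : set plane -> \bar R := @leb2 R.

Let sigma_finite_area : sigma_finite setT area.
Proof.
have /sigma_finiteP[F [TF ndF Foo]] := sigma_finiteT (@lebesgue_measure R).
exists (fun n => F n `*` F n).
  rewrite -setXTT TF predeqE => -[x y]; split.
    move=> [/= [n _ Fnx] [k _ Gky]]; exists (maxn n k) => //; split.
    - by move: x Fnx; exact/subsetPset/ndF/leq_maxl.
    - by move: y Gky; exact/subsetPset/ndF/leq_maxr.
  by move=> [n _ []/= ? ?]; split; exists n.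
move=> k; have [? ?] := Foo k.
split; first exact: measurableX.
by rewrite /area /leb2/= product_measure1E// lte_mul_pinfty// ge0_fin_numE.
Qed.

HB.instance Definition _ := Measure.on area.
HB.instance Definition _ := Measure_isSigmaFinite.Build _ _ _ area
  sigma_finite_area.

(** A product of Cauchy kernels of centre [x] and width [1 / T], not normalised. With [T = 1] it
    majorises the transform of [hat2]; with [T] a power of [1 + t] it is the envelope of the
    multiplier. *)
Definition cauchy2 T x y : R :=
  (oneDsqr (T * (y.1 - x.1)))^-1 * (oneDsqr (T * (y.2 - x.2)))^-1.

Lemma cauchy2_ge0 T x y : 0 <= cauchy2 T x y.
Proof. by rewrite mulr_ge0// invr_ge0 (le_trans ler01)// oneDsqr_ge1. Qed.

Lemma continuous_cauchy T (a : R) :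
  continuous (fun y : R => (oneDsqr (T * (y - a)))^-1).
Proof.
pose F (y : R) := T * (y - a).
move=> y; apply: (@continuous_comp _ _ _ F (fun u => (oneDsqr u)^-1)).
  by apply: cvgMr; apply: cvgB; [exact: cvg_id|exact: cvg_cst].
exact: continuous_oneDsqrV.
Qed.

Lemma measurable_cauchy T (a : R) :
  measurable_fun setT (fun y : measurableTypeR R => (oneDsqr (T * (y - a)))^-1).
Proof. by apply: continuous_measurable_fun; exact: continuous_cauchy. Qed.

Lemma measurable_cauchy2 T x : measurable_fun setT (cauchy2 T x).
Proof.
apply: measurable_funM.
  exact: (measurableT_comp (measurable_cauchy T x.1) measurable_fst).
exact: (measurableT_comp (measurable_cauchy T x.2) measurable_snd).
Qed.

Lemma integral_cauchy2 T x : 0 < T ->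
  (\int[area]_y (cauchy2 T x y)%:E = ((pi / T) ^+ 2)%:E)%E.
Proof.
move=> T0.
have c0 (a y : R) : 0 <= (oneDsqr (T * (y - a)))^-1.
  by rewrite invr_ge0 (le_trans ler01)// oneDsqr_ge1.
rewrite fubini_tonelli1.
- rewrite /fubini_F /cauchy2 /=.
  under eq_integral => u _.
    under eq_integral do rewrite EFinM.
    rewrite ge0_integralZl//; last first.
      by apply/measurable_EFinP; exact: measurable_cauchy.
    rewrite integral_cauchy// muleC.
    over.
  rewrite ge0_integralZl//; last 2 first.
  + by apply/measurable_EFinP; exact: measurable_cauchy.
  + by rewrite lee_fin divr_ge0// ?pi_ge0 ?ltW.
  by rewrite integral_cauchy// -EFinM expr2.
- by apply/measurable_EFinP; exact: measurable_cauchy2.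
- by move=> y; rewrite lee_fin cauchy2_ge0.
Qed.

Definition hat2 (xi : plane) : R := hat xi.1 * hat xi.2.

Lemma measurable_dotp :
  measurable_fun setT (fun p : plane * plane => dotp p.1 p.2).
Proof.
apply: measurable_funD; apply: measurable_funM.
- exact: (measurableT_comp measurable_fst measurable_fst).
- exact: (measurableT_comp measurable_fst measurable_snd).
- exact: (measurableT_comp measurable_snd measurable_fst).
- exact: (measurableT_comp measurable_snd measurable_snd).
Qed.

Lemma measurable_cos_dotp :
  measurable_fun setT (fun p : plane * plane => cos (dotp p.1 p.2)).
Proof.
apply: (measurableT_comp _ measurable_dotp).
by apply: continuous_measurable_fun; exact: continuous_cos.
Qed.

Lemma measurable_sin_dotp :
  measurable_fun setT (fun p : plane * plane => sin (dotp p.1 p.2)).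
Proof.
apply: (measurableT_comp _ measurable_dotp).
by apply: continuous_measurable_fun; exact: continuous_sin.
Qed.

Lemma norm_cos_le1 (u : R) : `|cos u| <= 1.
Proof. by rewrite ler_norml cos_geN1 cos_le1. Qed.

Lemma norm_sin_le1 (u : R) : `|sin u| <= 1.
Proof. by rewrite ler_norml sin_geN1 sin_le1. Qed.

Lemma integrable_hat2_kernel (c : plane -> R) :
  measurable_fun setT c -> (forall xi, `|c xi| <= 1) ->
  area.-integrable setT (fun xi => (hat2 xi * c xi)%:E).
Proof. by move=> mc c1; apply: integrable_prod_kernel => //; exact: integrable_hat. Qed.

Lemma integrable_hat2 : area.-integrable setT (EFin \o hat2).
Proof.
rewrite (_ : EFin \o hat2 = (fun xi => (hat2 xi * cst 1 xi)%:E)).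
  by apply: integrable_hat2_kernel => // xi; rewrite normr1.
by apply/funext => xi /=; rewrite mulr1.
Qed.

(** The first variable is a mere phase in the inner integral; it comes out as a cosine, the kernel
    of the outer one. *)
Lemma Rintegral_hat2_cos z :
  \int[area]_xi (hat2 xi * cos (dotp z xi)) = hat_fourier z.1 * hat_fourier z.2.
Proof.
have mc : measurable_fun setT (fun xi : plane => cos (dotp z xi)).
  exact: (measurableT_comp measurable_cos_dotp (pair1_measurable z)).
have ih : area.-integrable setT (fun xi => (hat2 xi * cos (dotp z xi))%:E).
  by apply: integrable_hat2_kernel => // xi; exact: norm_cos_le1.
transitivity (fine (hat_fourier z.1 * hat_fourier z.2)%:E) => //.
congr fine; rewrite -integral12_prod_meas1// /fubini_F.
transitivity (\int[@lebesgue_measure R]_u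
   ((hat_fourier z.2)%:E * (hat u * cos (z.1 * u + 0))%:E))%E.
  apply: eq_integral => u _.
  have -> : (fun v => (hat2 (u, v) * cos (dotp z (u, v)))%:E) =
     (fun v => (hat u)%:E * (hat v * cos (z.2 * v + z.1 * u))%:E)%E.
    apply/funext => v; rewrite -EFinM /hat2 /dotp/= (addrC (z.2 * v)).
    by rewrite mulrA.
  rewrite integralZl//; last exact: integrable_hat_cos.
  by rewrite integral_hat_cosE -!EFinM addr0; congr EFin; ring.
rewrite integralZl//; last exact: integrable_hat_cos.
by rewrite integral_hat_cosE -EFinM cos0 mul1r mulrC.
Qed.

(* The kernel [K (x - y) + K (x + y)] controls both the cosine and the sine
   transforms through the product formulas. *)
Definition hat_kernel (p : plane * plane) : R :=
  128 * (cauchy2 1 p.1 p.2 + cauchy2 1 (- p.1.1, - p.1.2) p.2).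

Lemma hat_fourier2_le z :
  `|hat_fourier z.1 * hat_fourier z.2| <=
    256 * ((oneDsqr z.1)^-1 * (oneDsqr z.2)^-1).
Proof.
rewrite normrM.
have -> : 256 * ((oneDsqr z.1)^-1 * (oneDsqr z.2)^-1) =
  (16 * (oneDsqr z.1)^-1) * (16 * (oneDsqr z.2)^-1) by ring.
by apply: ler_pM => //; exact: hat_fourier_le.
Qed.

Lemma measurable_hat_kernel : measurable_fun setT hat_kernel.
Proof.
have mc (f g : plane * plane -> R) : measurable_fun setT f -> measurable_fun setT g ->
    measurable_fun setT (fun p => (oneDsqr (f p))^-1 * (oneDsqr (g p))^-1).
  have mo : measurable_fun setT (fun u : R => (oneDsqr u)^-1).
    by apply: continuous_measurable_fun; exact: continuous_oneDsqrV.
  move=> mf mg; apply: measurable_funM; first exact: (measurableT_comp mo mf).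
  exact: (measurableT_comp mo mg).
have m11 : measurable_fun setT (fun p : plane * plane => p.1.1).
  exact: (measurableT_comp measurable_fst measurable_fst).
have m12 : measurable_fun setT (fun p : plane * plane => p.1.2).
  exact: (measurableT_comp measurable_snd measurable_fst).
have m21 : measurable_fun setT (fun p : plane * plane => p.2.1).
  exact: (measurableT_comp measurable_fst measurable_snd).
have m22 : measurable_fun setT (fun p : plane * plane => p.2.2).
  exact: (measurableT_comp measurable_snd measurable_snd).
have mN (f : plane * plane -> R) : measurable_fun setT f ->
    measurable_fun setT (fun p => - f p).
  by move=> mf; exact: measurable_funN.
apply: measurable_funM => //; apply: measurable_funD; apply: mc;
  apply: measurable_funM => //; apply: measurable_funB => //.
- exact: mN.
- exact: mN.
Qed.

Lemma integral_hat_kernel1 x :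
  (\int[area]_y (hat_kernel (x, y))%:E <= (256 * pi ^+ 2)%:E)%E.
Proof.
rewrite /hat_kernel /=.
under eq_integral do rewrite EFinM (EFinD (cauchy2 _ _ _)).
have c0 a y : (0 <= (cauchy2 1 a y)%:E)%E by rewrite lee_fin cauchy2_ge0.
have mc a : measurable_fun setT (fun y => (cauchy2 1 a y)%:E).
  by apply/measurable_EFinP; exact: measurable_cauchy2.
rewrite ge0_integralZl//.
- rewrite ge0_integralD// !integral_cauchy2// -EFinD -EFinM lee_fin divr1.
  by lra.
- exact: emeasurable_funD.
- by move=> y _; rewrite adde_ge0.
Qed.

Lemma hat_kernel_sym x y : hat_kernel (x, y) = hat_kernel (y, x).
Proof.
rewrite /hat_kernel /cauchy2 /= !mul1r /oneDsqr.
by congr (128 * (_^-1 * _^-1 + _^-1 * _^-1)); ring.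
Qed.

Lemma hat_kernel_ge0 p : 0 <= hat_kernel p.
Proof. by rewrite mulr_ge0// addr_ge0// cauchy2_ge0. Qed.

(** Common form of the product formulas, with [s = 1] for cosines and [s = -1] for sines. The
    integral is half a combination of transforms of [hat2] at [x - y] and [x + y]; half of
    [256 = 16 ^ 2] is the constant of [hat_kernel]. *)
Lemma hat2_kernel_le x y (s : R) (c : plane -> R) : `|s| <= 1 ->
  (forall xi, c xi = 2^-1 * (cos (dotp (x.1 - y.1, x.2 - y.2) xi) +
                             s * cos (dotp (x.1 + y.1, x.2 + y.2) xi))) ->
  `|\int[area]_xi (hat2 xi * c xi)| <= hat_kernel (x, y).
Proof.
move=> s1 cE.
set xm : plane := (x.1 - y.1, x.2 - y.2) in cE.
set xp : plane := (x.1 + y.1, x.2 + y.2) in cE.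
have ih z : area.-integrable setT (EFin \o (fun xi => hat2 xi * cos (dotp z xi))).
  apply: integrable_hat2_kernel => [|xi]; last exact: norm_cos_le1.
  exact: (measurableT_comp measurable_cos_dotp (pair1_measurable z)).
have ihs : area.-integrable setT
    (EFin \o (fun xi => s * (hat2 xi * cos (dotp xp xi)))).
  by apply: (integrableZl _ s (ih xp)).
have -> : \int[area]_xi (hat2 xi * c xi) =
    2^-1 * (hat_fourier xm.1 * hat_fourier xm.2 +
            s * (hat_fourier xp.1 * hat_fourier xp.2)).
  rewrite -!Rintegral_hat2_cos -RintegralZl// -RintegralD// -RintegralZl//.
    by apply: eq_Rintegral => xi _; rewrite cE; ring.
  by apply: (integrableD _ (ih xm) ihs).
rewrite normrM ger0_norm ?invr_ge0//.
have h1 := hat_fourier2_le xm; have h2 := hat_fourier2_le xp.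
have h3 : `|s * (hat_fourier xp.1 * hat_fourier xp.2)| <=
    256 * ((oneDsqr xp.1)^-1 * (oneDsqr xp.2)^-1).
  by rewrite normrM (le_trans _ h2)// -[leRHS]mul1r ler_wpM2r.
have -> : hat_kernel (x, y) = 2^-1 *
   (256 * ((oneDsqr xm.1)^-1 * (oneDsqr xm.2)^-1) +
    256 * ((oneDsqr xp.1)^-1 * (oneDsqr xp.2)^-1)).
  rewrite /hat_kernel /cauchy2 /xm /xp /oneDsqr /= !mul1r !opprK.
  rewrite -(sqrrN (x.1 - y.1)) -(sqrrN (x.2 - y.2)) !opprB.
  rewrite (addrC y.1 x.1) (addrC y.2 x.2).
  by move: (_ / (1 + (y.2 - _) ^+ 2)) (_ / (1 + (x.2 + _) ^+ 2)) => u v; lra.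
by rewrite ler_wpM2l ?invr_ge0// (le_trans (ler_normD _ _))// lerD.
Qed.

Let dotpB x y xi : dotp (x.1 - y.1, x.2 - y.2) xi = dotp x xi - dotp y xi.
Proof. by rewrite /dotp /=; ring. Qed.

Let dotpD x y xi : dotp (x.1 + y.1, x.2 + y.2) xi = dotp x xi + dotp y xi.
Proof. by rewrite /dotp /=; ring. Qed.

Lemma hat2_cos_kernel x y :
  `|\int[area]_xi (hat2 xi * cos (dotp x xi) * cos (dotp y xi))| <=
    hat_kernel (x, y).
Proof.
under eq_Rintegral do rewrite -mulrA.
apply: (@hat2_kernel_le x y 1); first by rewrite normr1.
by move=> xi; rewrite dotpB dotpD cosB cosD; field.
Qed.

Lemma hat2_sin_kernel x y :
  `|\int[area]_xi (hat2 xi * sin (dotp x xi) * sin (dotp y xi))| <=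
    hat_kernel (x, y).
Proof.
under eq_Rintegral do rewrite -mulrA.
apply: (@hat2_kernel_le x y (-1)); first by rewrite normrN1.
by move=> xi; rewrite dotpB dotpD cosB cosD; field.
Qed.

(** Weighting the frequencies by [hat2] is what makes the kernel of the quadratic form integrable;
    the constant bounds both of its marginals. *)
Lemma local_plancherel (e : plane * plane -> R) (f : plane -> R) :
  (e = (fun p => cos (dotp p.1 p.2)) \/ e = (fun p => sin (dotp p.1 p.2))) ->
  area.-integrable setT (EFin \o f) ->
  (\int[area]_xi (hat2 xi * (\int[area]_x (f x * e (x, xi)))%R ^+ 2)%:E
    <= (256 * pi ^+ 2)%:E * \int[area]_x (f x ^+ 2)%:E)%E.
Proof.
move=> eE intf; apply: (@tt_star _ _ _ area _ _ _ hat_kernel) => //.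
- exact: integrable_hat2.
- by move=> xi; rewrite mulr_ge0// hat_ge0.
- by case: eE => ->; [exact: measurable_cos_dotp|exact: measurable_sin_dotp].
- by case: eE => -> p; [exact: norm_cos_le1|exact: norm_sin_le1].
- exact: measurable_hat_kernel.
- exact: hat_kernel_ge0.
- exact: integral_hat_kernel1.
- move=> y; under eq_integral do rewrite hat_kernel_sym.
  exact: integral_hat_kernel1.
- by case: eE => -> x y; [exact: hat2_cos_kernel|exact: hat2_sin_kernel].
Qed.

End LocalPlancherel.

Lemma ge0_integralZl_real d (T : measurableType d) (R : realType)
    (mu : {measure set T -> \bar R}) (k : R) (f : T -> R) :
  0 <= k -> measurable_fun setT f -> (forall x, 0 <= f x) ->
  (\int[mu]_x (k%:E * (f x)%:E) = k%:E * \int[mu]_x (f x)%:E)%E.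
Proof.
move=> k0 mf f0; rewrite ge0_integralZl//.
- by apply/measurable_EFinP.
- by move=> x _; rewrite lee_fin.
Qed.

(** * Truncation of functions of L^m *)

Section Truncation.
Context {R : realType}.
Local Notation plane := (measurableTypeR R * measurableTypeR R)%type.
Implicit Types (la m y : R).

Lemma powRD_gt0 (x u v : R) : 0 < x -> x `^ (u + v) = x `^ u * x `^ v.
Proof. by move=> x0; rewrite powRD// (gt_eqF x0) implybT. Qed.

(** With [trunc_lo], this turns a bound in L^m into one in L^1 above the level and one in L^2 below
    it, by inserting a power of the ratio of [y] and [la] that is at least 1. *)
Lemma trunc_hi la m y : 0 < la -> 1 <= m -> la < y ->
  y <= la `^ (1 - m) * y `^ m.
Proof.
move=> la0 m1 lay; have y0 : 0 < y by apply: lt_trans lay.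
have -> : y `^ m = y * y `^ (m - 1).
  have := powRD_gt0 1 (m - 1) y0.
  by rewrite powRr1 ?(ltW y0)// [1 + _]addrC subrK.
rewrite mulrCA -[leLHS]mulr1 ler_wpM2l ?(ltW y0)//.
have -> : la `^ (1 - m) = (la `^ (m - 1))^-1 by rewrite -powRN opprB.
rewrite mulrC ler_pdivlMr ?powR_gt0// mul1r ge0_ler_powR ?nnegrE ?subr_ge0//; exact: ltW.
Qed.

Lemma trunc_lo la m y : 0 < la -> m <= 2 -> 0 <= y -> y <= la ->
  y ^+ 2 <= la `^ (2 - m) * y `^ m.
Proof.
move=> la0 m2; rewrite le_eqVlt => /orP[/eqP <- _|y0 yla].
  by rewrite expr0n/= mulr_ge0// powR_ge0.
have -> : y ^+ 2 = y `^ (2 - m) * y `^ m.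
  by rewrite -powRD_gt0// subrK powR_mulrn// ltW.
rewrite ler_wpM2r ?powR_ge0// ge0_ler_powR ?nnegrE ?subr_ge0//; exact: ltW.
Qed.

(* At the level [la = A be^(1/m)] both parts of the truncated function give the
   same bound. *)
Lemma trunc_balance (be m A : R) : 0 < be -> 0 < m -> 0 < A ->
  let la := A * be `^ (m^-1) in
  be * (la `^ (1 - m) * A `^ m) ^+ 2 = be `^ ((2 - m) / m) * A ^+ 2 /\
  la `^ (2 - m) * A `^ m = be `^ ((2 - m) / m) * A ^+ 2.
Proof.
move=> be0 m0 A0 la.
have m_neq0 : m != 0 by rewrite gt_eqF.
have p0 : 0 < be `^ m^-1 by rewrite powR_gt0.
have laE (u : R) : la `^ u = A `^ u * be `^ (u / m).
  by rewrite /la powRM ?(ltW A0) ?(ltW p0)// -powRrM (mulrC m^-1).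
have AD (u v : R) : A `^ (u + v) = A `^ u * A `^ v.
  exact: powRD_gt0.
have beD (u v : R) : be `^ (u + v) = be `^ u * be `^ v.
  exact: powRD_gt0.
split; rewrite laE.
- rewrite mulrAC -AD subrK powRr1 ?(ltW A0)// exprMn mulrCA mulrC; congr (_ * _).
  rewrite -{1}(powRr1 (ltW be0)) expr2 -!beD; congr (be `^ _).
  by field.
- rewrite mulrAC -AD subrK mulrC; congr (_ * _).
  by rewrite powR_mulrn// ltW.
Qed.

End Truncation.

(** * The multiplier estimate for scalar integrable functions *)

Section Multiplier.
Context {R : realType}.
Local Notation plane := (measurableTypeR R * measurableTypeR R)%type.

(** The pointwise bound of [w] serves the L^2 part, its mass the bounded transform of the L^1 part.
    The exponent [(2 - m) / m] runs from 1 at [m = 1], where the full factor [be] is gained, to 0 at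
    [m = 2]. In the constant, 1 and [256 pi ^ 2] belong to the two parts, and 2 to the square of
    their sum. *)
Lemma multiplier_scalar (e : plane * plane -> R) (f w : plane -> R)
    (al be m A : R) :
  (e = (fun p => cos (dotp p.1 p.2)) \/ e = (fun p => sin (dotp p.1 p.2))) ->
  area.-integrable setT (EFin \o f) ->
  measurable_fun setT w -> (forall xi, 0 <= w xi) ->
  0 <= al -> 0 < be -> (forall xi, w xi <= al * hat2 xi) ->
  (\int[area]_xi (w xi)%:E <= (al * be)%:E)%E ->
  1 <= m -> m <= 2 -> 0 < A ->
  (\int[area]_x (`|f x| `^ m)%:E <= (A `^ m)%:E)%E ->
  (\int[area]_xi (w xi * (\int[area]_x (f x * e (x, xi)))%R ^+ 2)%:E
    <= (2 * (1 + 256 * pi ^+ 2) * al * be `^ ((2 - m) / m) * A ^+ 2)%:E)%E.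
Proof.
move=> eE intf mw w0 al0 be0 wal wbe m1 m2 A0 fA.
have m0 : 0 < m by lra.
set la := A * be `^ m^-1.
have la0 : 0 < la by rewrite mulr_gt0// powR_gt0.
have [bal1 bal2] := trunc_balance be0 m0 A0.
rewrite -/la in bal1 bal2.
have mf : measurable_fun setT f by apply/measurable_EFinP; exact: (measurable_int _ intf).
have maf : measurable_fun setT (fun x => `|f x|) by exact: measurableT_comp.
have me : measurable_fun setT e.
  by case: eE => ->; [exact: measurable_cos_dotp|exact: measurable_sin_dotp].
have e1 p : `|e p| <= 1.
  by case: eE => ->; [exact: norm_cos_le1|exact: norm_sin_le1].
pose f1 x := if la < `|f x| then f x else 0.
pose f2 x := if la < `|f x| then 0 else f x.
have mset : measurable_fun setT (fun x => la < `|f x|).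
  by apply: measurable_fun_ltr.
have mf1 : measurable_fun setT f1 by exact: measurable_fun_ifT.
have mf2 : measurable_fun setT f2 by exact: measurable_fun_ifT.
have if1 : area.-integrable setT (EFin \o f1).
  apply: (le_integrable measurableT) intf; first exact/measurable_EFinP.
  by move=> x _; rewrite /= lee_fin /f1; case: ifP => // _; rewrite normr0.
have if2 : area.-integrable setT (EFin \o f2).
  apply: (le_integrable measurableT) intf; first exact/measurable_EFinP.
  by move=> x _; rewrite /= lee_fin /f2; case: ifP => // _; rewrite normr0.
pose F (h : plane -> R) xi := \int[area]_x (h x * e (x, xi)).
have mF h : measurable_fun setT h -> measurable_fun setT (F h).
  move=> mh; apply: (@measurable_Rintegral_pair _ _ _ area _ _ (fun u => h u.2 * e (u.2, u.1))).
  apply: measurable_funM; first exact: measurableT_comp.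
  by apply: (measurableT_comp me); exact: measurable_swap.
have FE xi : F f xi = F f1 xi + F f2 xi.
  have me2 : measurable_fun setT (fun x => e (x, xi)).
    exact: (measurableT_comp me (pair2_measurable xi)).
  rewrite /F -RintegralD//; last 2 first.
  - exact: integrable_kernel.
  - exact: integrable_kernel.
  apply: eq_Rintegral => x _; rewrite -mulrDl; congr (_ * _).
  by rewrite /f1 /f2; case: ifP; rewrite ?addr0 ?add0r.
have mafm : measurable_fun setT (fun x => `|f x| `^ m).
  exact: (measurableT_comp (measurable_powR m)).
have B1 : (\int[area]_x (`|f1 x|)%:E <= (la `^ (1 - m) * A `^ m)%:E)%E.
  apply: (@le_trans _ _ (\int[area]_x ((la `^ (1 - m))%:E * (`|f x| `^ m)%:E))%E).
    apply: ge0_le_integral => //.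
    - by apply/measurable_EFinP; exact: measurableT_comp.
    - by apply: measurable_funeM; exact/measurable_EFinP.
    - move=> x _; rewrite -EFinM lee_fin /f1; case: ifP => [h|_].
        exact: trunc_hi.
      by rewrite normr0 mulr_ge0// powR_ge0.
  rewrite (ge0_integralZl_real _ (powR_ge0 _ _) mafm) => [|x]; last exact: powR_ge0.
  by rewrite EFinM lee_wpmul2l// lee_fin powR_ge0.
have B2 : (\int[area]_x (f2 x ^+ 2)%:E <= (la `^ (2 - m) * A `^ m)%:E)%E.
  apply: (@le_trans _ _ (\int[area]_x ((la `^ (2 - m))%:E * (`|f x| `^ m)%:E))%E).
    apply: ge0_le_integral => //.
    - by move=> x _; rewrite lee_fin sqr_ge0.
    - by apply/measurable_EFinP; exact: measurable_funX.
    - by apply: measurable_funeM; exact/measurable_EFinP.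
    - move=> x _; rewrite -EFinM lee_fin /f2; case: ifPn => [h|].
        by rewrite expr0n/= mulr_ge0// powR_ge0.
      by rewrite -leNgt => h; rewrite -real_normK ?num_real// trunc_lo.
  rewrite (ge0_integralZl_real _ (powR_ge0 _ _) mafm) => [|x]; last exact: powR_ge0.
  by rewrite EFinM lee_wpmul2l// lee_fin powR_ge0.
have mwF h : measurable_fun setT h ->
    measurable_fun setT (fun xi => (w xi * F h xi ^+ 2)%:E).
  move=> mh; apply/measurable_EFinP; apply: measurable_funM => //.
  by apply: measurable_funX; exact: mF.
have wF0 h xi : (0 <= (w xi * F h xi ^+ 2)%:E)%E.
  by rewrite lee_fin mulr_ge0// sqr_ge0.
set L := la `^ (1 - m) * A `^ m in B1 bal1.
have L0 : 0 <= L by rewrite mulr_ge0// powR_ge0.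
have FL xi : `|F f1 xi| <= L.
  have me2 : measurable_fun setT (fun x => e (x, xi)).
    exact: (measurableT_comp me (pair2_measurable xi)).
  apply: (le_trans (norm_Rintegral_kernel if1 me2 (fun x => e1 (x, xi)))).
  rewrite -lee_fin; apply: le_trans B1.
  rewrite fineK//; apply: integrable_fin_num => //.
  exact: (integrable_norm if1).
have D1 : (\int[area]_xi (w xi * F f1 xi ^+ 2)%:E <=
    (al * (be `^ ((2 - m) / m) * A ^+ 2))%:E)%E.
  apply: (@le_trans _ _ (\int[area]_xi ((L ^+ 2)%:E * (w xi)%:E))%E).
    apply: ge0_le_integral => //.
    - exact: mwF.
    - by apply: measurable_funeM; exact/measurable_EFinP.
    - move=> xi _; rewrite -EFinM lee_fin mulrC ler_wpM2r//.
      by rewrite -real_normK ?num_real// lerXn2r ?nnegrE.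
  rewrite ge0_integralZl_real ?sqr_ge0//.
  apply: (@le_trans _ _ ((L ^+ 2)%:E * (al * be)%:E)%E).
    by rewrite lee_wpmul2l// lee_fin sqr_ge0.
  by rewrite -EFinM lee_fin -bal1 mulrCA (mulrC (L ^+ 2)).
have D2 : (\int[area]_xi (w xi * F f2 xi ^+ 2)%:E <=
    (256 * pi ^+ 2 * (al * (be `^ ((2 - m) / m) * A ^+ 2)))%:E)%E.
  have h2F xi : (0 <= (hat2 xi * F f2 xi ^+ 2)%:E)%E.
    by rewrite lee_fin mulr_ge0 ?sqr_ge0// mulr_ge0// hat_ge0.
  have mh2F : measurable_fun setT (fun xi => (hat2 xi * F f2 xi ^+ 2)%:E).
    apply/measurable_EFinP; apply: measurable_funM.
      by apply/measurable_EFinP; exact: (measurable_int _ integrable_hat2).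
    by apply: measurable_funX; exact: mF.
  apply: (@le_trans _ _ (\int[area]_xi (al%:E * (hat2 xi * F f2 xi ^+ 2)%:E))%E).
    apply: ge0_le_integral => //.
    - exact: mwF.
    - exact: measurable_funeM.
    - by move=> xi _; rewrite -EFinM lee_fin [leRHS]mulrA ler_wpM2r// sqr_ge0.
  rewrite ge0_integralZl//.
  have -> : 256 * pi ^+ 2 * (al * (be `^ ((2 - m) / m) * A ^+ 2)) =
     al * (256 * pi ^+ 2 * (be `^ ((2 - m) / m) * A ^+ 2)) by ring.
  rewrite EFinM lee_wpmul2l// (le_trans (local_plancherel eE if2))//.
  rewrite [leRHS]EFinM; apply: lee_wpmul2l.
    by rewrite lee_fin; apply: mulr_ge0; [exact: ler0n|exact: sqr_ge0].
  by rewrite -bal2.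
apply: (@le_trans _ _ (\int[area]_xi
   (2%:E * ((w xi * F f1 xi ^+ 2)%:E + (w xi * F f2 xi ^+ 2)%:E)))%E).
  apply: ge0_le_integral => //.
  - by move=> xi _; exact: (wF0 f xi).
  - exact: (mwF f mf).
  - by apply: measurable_funeM; apply: emeasurable_funD; exact: mwF.
  - move=> xi _; rewrite -/(F f xi) FE -EFinD -EFinM lee_fin.
    have : (F f1 xi + F f2 xi) ^+ 2 <= 2 * (F f1 xi ^+ 2 + F f2 xi ^+ 2).
      by have := sqr_ge0 (F f1 xi - F f2 xi); rewrite sqrrB sqrrD; lra.
    by move=> /(ler_wpM2l (w0 xi)); lra.
rewrite ge0_integralZl//; last 2 first.
- by apply: emeasurable_funD; exact: mwF.
- by move=> xi _; rewrite adde_ge0.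
rewrite ge0_integralD//; last 2 first.
- exact: mwF.
- exact: mwF.
apply: (@le_trans _ _ (2%:E * ((al * (be `^ ((2 - m) / m) * A ^+ 2))%:E +
   (256 * pi ^+ 2 * (al * (be `^ ((2 - m) / m) * A ^+ 2)))%:E))%E).
  by rewrite lee_wpmul2l// leeD.
by rewrite -EFinD -EFinM lee_fin; lra.
Qed.

End Multiplier.

(** * Norms of functions with values in C^4 *)

Section VectorNorm.
Context {R : realType}.
Local Notation plane := (measurableTypeR R * measurableTypeR R)%type.
Implicit Types (v z : 'cV[R[i]]_4) (u : R * R -> 'cV[R[i]]_4).

Lemma cvnorm_ge0 v : 0 <= cvnorm v.
Proof. exact: sqrtr_ge0. Qed.

Lemma cvnorm_sqr v :
  cvnorm v ^+ 2 = \sum_i (complex.Re (v i 0) ^+ 2 + complex.Im (v i 0) ^+ 2).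
Proof.
rewrite /cvnorm sqr_sqrtr; last by apply: sumr_ge0 => i _; rewrite sqr_ge0.
apply: eq_bigr => i _; case: (v i 0) => x y /=.
by rewrite sqr_sqrtr// addr_ge0// sqr_ge0.
Qed.

Lemma cvnorm_sqr_comp v i :
  complex.Re (v i 0) ^+ 2 + complex.Im (v i 0) ^+ 2 <= cvnorm v ^+ 2.
Proof.
rewrite cvnorm_sqr (bigD1 i)//= lerDl sumr_ge0// => j _.
by rewrite addr_ge0// sqr_ge0.
Qed.

Lemma Re_le_cvnorm v i : `|complex.Re (v i 0)| <= cvnorm v.
Proof.
rewrite -ler_sqr ?nnegrE ?cvnorm_ge0// real_normK ?num_real//.
by apply: le_trans (cvnorm_sqr_comp v i); rewrite lerDl sqr_ge0.
Qed.

Lemma Im_le_cvnorm v i : `|complex.Im (v i 0)| <= cvnorm v.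
Proof.
rewrite -ler_sqr ?nnegrE ?cvnorm_ge0// real_normK ?num_real//.
by apply: le_trans (cvnorm_sqr_comp v i); rewrite lerDr sqr_ge0.
Qed.

Lemma ReD (x y : R[i]) : complex.Re (x + y) = complex.Re x + complex.Re y.
Proof. by case: x y => ? ? []. Qed.

Lemma ImD (x y : R[i]) : complex.Im (x + y) = complex.Im x + complex.Im y.
Proof. by case: x y => ? ? []. Qed.

Lemma cvnorm_sqrD v z : cvnorm (v + z) ^+ 2 <= 2 * (cvnorm v ^+ 2 + cvnorm z ^+ 2).
Proof.
rewrite !cvnorm_sqr -big_split mulr_sumr; apply: ler_sum => i _.
rewrite /= mxE ReD ImD.
have := sqr_ge0 (complex.Re (v i 0) - complex.Re (z i 0)).
have := sqr_ge0 (complex.Im (v i 0) - complex.Im (z i 0)).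
by rewrite !sqrrB !sqrrD; lra.
Qed.

Lemma cvnormD v z : cvnorm (v + z) <= 2 * Num.max (cvnorm v) (cvnorm z).
Proof.
have m0 : 0 <= Num.max (cvnorm v) (cvnorm z) by rewrite le_max cvnorm_ge0.
rewrite -ler_sqr ?nnegrE ?cvnorm_ge0 ?mulr_ge0//.
apply: (le_trans (cvnorm_sqrD _ _)).
have h1 : cvnorm v <= Num.max (cvnorm v) (cvnorm z) by rewrite le_max lexx.
have h2 : cvnorm z <= Num.max (cvnorm v) (cvnorm z) by rewrite le_max lexx orbT.
have : cvnorm v ^+ 2 <= Num.max (cvnorm v) (cvnorm z) ^+ 2.
  by rewrite lerXn2r ?nnegrE ?cvnorm_ge0.
have : cvnorm z ^+ 2 <= Num.max (cvnorm v) (cvnorm z) ^+ 2.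
  by rewrite lerXn2r ?nnegrE ?cvnorm_ge0.
by rewrite exprMn; lra.
Qed.

Lemma cvnorm_powRD (m : R) v z : 0 <= m -> m <= 2 ->
  cvnorm (v + z) `^ m <= 4 * (cvnorm v `^ m + cvnorm z `^ m).
Proof.
move=> m0 m2.
have M0 : 0 <= Num.max (cvnorm v) (cvnorm z) by rewrite le_max cvnorm_ge0.
apply: (@le_trans _ _ ((2 * Num.max (cvnorm v) (cvnorm z)) `^ m)).
  by rewrite ge0_ler_powR ?nnegrE ?cvnorm_ge0 ?mulr_ge0// cvnormD.
rewrite powRM//; apply: ler_pM; rewrite ?powR_ge0//.
  have -> : 4 = 2 `^ 2 :> R by rewrite powR_mulrn// -natrX.
  by rewrite ler_powR// ler1n.
rewrite /Num.max; case: ifP => _; first by rewrite lerDr powR_ge0.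
by rewrite lerDl powR_ge0.
Qed.

Lemma measurable_cvnorm u : vmeasurable u ->
  measurable_fun setT (fun x : plane => cvnorm (u x)).
Proof.
move=> mu.
have -> : (fun x : plane => cvnorm (u x)) = (fun x : plane => Num.sqrt
    (\sum_i (complex.Re (u x i 0) ^+ 2 + complex.Im (u x i 0) ^+ 2))).
  by apply/funext => x; rewrite -cvnorm_sqr sqrtr_sqr ger0_norm ?cvnorm_ge0.
apply: (measurableT_comp (f := @Num.sqrt R)).
  by apply: continuous_measurable_fun; exact: sqrt_continuous.
apply: measurable_sum => i; have [mr mi] := mu i.
by apply: measurable_funD; exact: measurable_funX.
Qed.

Lemma vmeasurableB u u' : vmeasurable u -> vmeasurable u' ->
  vmeasurable (fun x => u x - u' x).
Proof.
move=> mu mu' i; have [mr mi] := mu i; have [mr' mi'] := mu' i.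
split.
  rewrite (_ : (fun x : plane => _) = (fun x : plane => complex.Re (u x i 0)) \-
    (fun x => complex.Re (u' x i 0))); first exact: measurable_funB.
  by apply/funext => x; rewrite !mxE ReD /=; case: (u' x i 0).
rewrite (_ : (fun x : plane => _) = (fun x : plane => complex.Im (u x i 0)) \-
  (fun x => complex.Im (u' x i 0))); first exact: measurable_funB.
by apply/funext => x; rewrite !mxE ImD /=; case: (u' x i 0).
Qed.

Lemma Lp_norm_poweR (p : R) u : 0 < p ->
  (Lp_norm p%:E u `^ p = \int[area]_x (cvnorm (u x) `^ p)%:E)%E.
Proof.
move=> p0; rewrite /Lp_norm unlock -poweRrM mulVf ?gt_eqF// poweRe1.
  by apply: eq_integral => x _; rewrite /= ger0_norm ?cvnorm_ge0.
by apply: integral_ge0 => x _; rewrite poweR_ge0.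
Qed.

Lemma Lp_norm_ge0 p u : (0 <= Lp_norm p u)%E.
Proof. exact: Lnorm_ge0. Qed.

Lemma Lp_norm_le (p A : R) u : 0 < p -> 0 <= A ->
  (Lp_norm p%:E u <= A%:E)%E <->
  (\int[area]_x (cvnorm (u x) `^ p)%:E <= (A `^ p)%:E)%E.
Proof.
move=> p0 A0; rewrite -Lp_norm_poweR//.
rewrite -poweR_EFin.
have mono r (x y : \bar R) : (0 < r)%R -> (0 <= x)%E -> (0 <= y)%E -> (x <= y)%E ->
    (x `^ r <= y `^ r)%E.
  move=> r0 x0 y0 xy; apply: gt0_ler_poweR => //; first exact: ltW.
    by rewrite in_itv/= x0 leey.
  by rewrite in_itv/= y0 leey.
split=> h; first by apply: mono => //; exact: Lp_norm_ge0.
have := mono p^-1 _ _ _ _ _ h; rewrite -!poweRrM mulfV ?gt_eqF// !poweRe1//.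
  by apply; rewrite ?invr_gt0 ?poweR_ge0.
exact: Lp_norm_ge0.
Qed.

End VectorNorm.

(** * Vector transforms through real cosine and sine transforms *)

Section VectorFourier.
Context {R : realType}.
Local Notation plane := (measurableTypeR R * measurableTypeR R)%type.
Implicit Types (u : R * R -> 'cV[R[i]]_4).

Lemma Lp1_integrable u : in_Lp 1%:E u ->
  area.-integrable setT (EFin \o (fun x => cvnorm (u x))).
Proof.
move=> [mu uoo]; apply/integrableP; split.
  by apply/measurable_EFinP; exact: measurable_cvnorm.
move: uoo; rewrite /Lp_norm unlock invr1 poweRe1; last first.
  by apply: integral_ge0 => x _; rewrite poweR_ge0.
by under eq_integral do rewrite poweRe1 ?abse_ge0//.
Qed.

Lemma Lp1_integrable_Re u i : in_Lp 1%:E u ->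
  area.-integrable setT (EFin \o (fun x => complex.Re (u x i 0))).
Proof.
move=> uL; have [mu _] := uL; have [mr _] := mu i.
apply: (le_integrable measurableT) (Lp1_integrable uL) => //.
  exact/measurable_EFinP.
by move=> x _; rewrite /= lee_fin (ger0_norm (cvnorm_ge0 _)) Re_le_cvnorm.
Qed.

Lemma Lp1_integrable_Im u i : in_Lp 1%:E u ->
  area.-integrable setT (EFin \o (fun x => complex.Im (u x i 0))).
Proof.
move=> uL; have [mu _] := uL; have [_ mi] := mu i.
apply: (le_integrable measurableT) (Lp1_integrable uL) => //.
  exact/measurable_EFinP.
by move=> x _; rewrite /= lee_fin (ger0_norm (cvnorm_ge0 _)) Im_le_cvnorm.
Qed.

Definition cos_transform (f : plane -> R) xi :=
  \int[area]_x (f x * cos (dotp x xi)).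

Definition sin_transform (f : plane -> R) xi :=
  \int[area]_x (f x * sin (dotp x xi)).

Lemma integrable_cos_dotp (f : plane -> R) xi :
  area.-integrable setT (EFin \o f) ->
  area.-integrable setT (EFin \o (fun x => f x * cos (dotp x xi))).
Proof.
move=> intf; apply: integrable_kernel => // [|x]; last exact: norm_cos_le1.
exact: (measurableT_comp measurable_cos_dotp (pair2_measurable xi)).
Qed.

Lemma integrable_sin_dotp (f : plane -> R) xi :
  area.-integrable setT (EFin \o f) ->
  area.-integrable setT (EFin \o (fun x => f x * sin (dotp x xi))).
Proof.
move=> intf; apply: integrable_kernel => // [|x]; last exact: norm_sin_le1.
exact: (measurableT_comp measurable_sin_dotp (pair2_measurable xi)).
Qed.

Lemma fourier_Re u xi i : in_Lp 1%:E u ->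
  complex.Re (fourier_L1 u xi i 0) = (2 * pi)^-1 *
    (cos_transform (fun x => complex.Re (u x i 0)) xi +
     sin_transform (fun x => complex.Im (u x i 0)) xi).
Proof.
move=> uL; rewrite mxE /= mul0r subr0; congr (_ * _).
rewrite /cos_transform /sin_transform -RintegralD//.
- apply: eq_Rintegral => x _; rewrite /cexpi cosN sinN.
  by case: (u x i 0) => a b /=; ring.
- exact: integrable_cos_dotp (Lp1_integrable_Re _ uL).
- exact: integrable_sin_dotp (Lp1_integrable_Im _ uL).
Qed.

Lemma fourier_Im u xi i : in_Lp 1%:E u ->
  complex.Im (fourier_L1 u xi i 0) = (2 * pi)^-1 *
    (cos_transform (fun x => complex.Im (u x i 0)) xi -
     sin_transform (fun x => complex.Re (u x i 0)) xi).
Proof.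
move=> uL; rewrite mxE /= mul0r addr0; congr (_ * _).
rewrite /cos_transform /sin_transform -RintegralB//.
- apply: eq_Rintegral => x _; rewrite /cexpi cosN sinN.
  by case: (u x i 0) => a b /=; ring.
- exact: integrable_cos_dotp (Lp1_integrable_Im _ uL).
- exact: integrable_sin_dotp (Lp1_integrable_Re _ uL).
Qed.

Lemma measurable_cos_transform (f : plane -> R) : measurable_fun setT f ->
  measurable_fun setT (cos_transform f).
Proof.
move=> mf; apply: (@measurable_Rintegral_pair _ _ _ area _ _
  (fun p => f p.2 * cos (dotp p.2 p.1))).
apply: measurable_funM; first exact: measurableT_comp.
exact: (measurableT_comp measurable_cos_dotp (@measurable_swap _ _ plane plane)).
Qed.

Lemma measurable_sin_transform (f : plane -> R) : measurable_fun setT f ->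
  measurable_fun setT (sin_transform f).
Proof.
move=> mf; apply: (@measurable_Rintegral_pair _ _ _ area _ _
  (fun p => f p.2 * sin (dotp p.2 p.1))).
apply: measurable_funM; first exact: measurableT_comp.
exact: (measurableT_comp measurable_sin_dotp (@measurable_swap _ _ plane plane)).
Qed.

Lemma vmeasurable_fourier u : in_Lp 1%:E u -> vmeasurable (fourier_L1 u).
Proof.
move=> uL; have [mu _] := uL => i; have [mr mi] := mu i; split.
  rewrite (_ : (fun xi : plane => _) = (fun xi => (2 * pi)^-1 *
    (cos_transform (fun x => complex.Re (u x i 0)) xi +
     sin_transform (fun x => complex.Im (u x i 0)) xi))).
    apply: measurable_funM => //; apply: measurable_funD.
      exact: measurable_cos_transform.
    exact: measurable_sin_transform.
  by apply/funext => xi; exact: fourier_Re.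
rewrite (_ : (fun xi : plane => _) = (fun xi => (2 * pi)^-1 *
    (cos_transform (fun x => complex.Im (u x i 0)) xi -
     sin_transform (fun x => complex.Re (u x i 0)) xi))).
  apply: measurable_funM => //; apply: measurable_funB.
    exact: measurable_cos_transform.
  exact: measurable_sin_transform.
by apply/funext => xi; exact: fourier_Im.
Qed.

Lemma cvnorm_fourier_sqr_le u xi : in_Lp 1%:E u ->
  cvnorm (fourier_L1 u xi) ^+ 2 <=
  \sum_i (2 * ((cos_transform (fun x => complex.Re (u x i 0)) xi) ^+ 2 +
               (sin_transform (fun x => complex.Im (u x i 0)) xi) ^+ 2 +
               (cos_transform (fun x => complex.Im (u x i 0)) xi) ^+ 2 +
               (sin_transform (fun x => complex.Re (u x i 0)) xi) ^+ 2)).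
Proof.
move=> uL; rewrite cvnorm_sqr; apply: ler_sum => i _.
rewrite fourier_Re// fourier_Im// !exprMn -mulrDr.
set a := cos_transform _ _; set b := sin_transform _ _.
set c := cos_transform _ _; set d := sin_transform _ _.
have p1 : (2 * pi)^-1 ^+ 2 <= 1 :> R.
  rewrite expr_le1// ?invr_ge0 ?mulr_ge0 ?pi_ge0// invf_le1 ?mulr_gt0 ?pi_gt0//.
  by have := @pi_ge2 R; lra.
have h : (a + b) ^+ 2 + (c - d) ^+ 2 <= 2 * (a ^+ 2 + b ^+ 2 + c ^+ 2 + d ^+ 2).
  have := sqr_ge0 (a - b); have := sqr_ge0 (c + d).
  by rewrite !sqrrB !sqrrD; lra.
apply: (le_trans _ h); rewrite -[leRHS]mul1r ler_wpM2r//.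
by rewrite addr_ge0// sqr_ge0.
Qed.

(** Four components with four real transforms each, all dominated through [cvnorm]; with the factors
    2 of [cvnorm_fourier_sqr_le] and of the scalar estimate this makes [64 = 4 * 4 * 2 * 2]. *)
Lemma multiplier_vector u (w : plane -> R) (al be m A : R) :
  in_Lp 1%:E u ->
  measurable_fun setT w -> (forall xi, 0 <= w xi) ->
  0 <= al -> 0 < be -> (forall xi, w xi <= al * hat2 xi) ->
  (\int[area]_xi (w xi)%:E <= (al * be)%:E)%E ->
  1 <= m -> m <= 2 -> 0 < A ->
  (\int[area]_x (cvnorm (u x) `^ m)%:E <= (A `^ m)%:E)%E ->
  (\int[area]_xi (w xi * cvnorm (fourier_L1 u xi) ^+ 2)%:E
    <= (64 * (1 + 256 * pi ^+ 2) * al * be `^ ((2 - m) / m) * A ^+ 2)%:E)%E.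
Proof.
move=> uL mw w0 al0 be0 wal wbe m1 m2 A0 uA.
have [mu _] := uL.
set B := 2 * (1 + 256 * pi ^+ 2) * al * be `^ ((2 - m) / m) * A ^+ 2.
have m0 : 0 <= m by lra.
have mcv : measurable_fun setT (fun x : plane => cvnorm (u x) `^ m).
  exact: (measurableT_comp (measurable_powR m) (measurable_cvnorm mu)).
have le_m (f : plane -> R) : measurable_fun setT f ->
    (forall x, `|f x| <= cvnorm (u x)) ->
    (\int[area]_x (`|f x| `^ m)%:E <= (A `^ m)%:E)%E.
  move=> mf fu; apply: le_trans uA; apply: ge0_le_integral => //.
  - apply/measurable_EFinP; apply: (measurableT_comp (measurable_powR m)).
    exact: measurableT_comp.
  - exact/measurable_EFinP.
  - by move=> x _; rewrite lee_fin ge0_ler_powR ?nnegrE ?cvnorm_ge0.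
pose Cr i := cos_transform (fun x => complex.Re (u x i 0)).
pose Ci i := cos_transform (fun x => complex.Im (u x i 0)).
pose Sr i := sin_transform (fun x => complex.Re (u x i 0)).
pose Si i := sin_transform (fun x => complex.Im (u x i 0)).
have mr i : measurable_fun setT (fun x : plane => complex.Re (u x i 0)) by have [] := mu i.
have mi i : measurable_fun setT (fun x : plane => complex.Im (u x i 0)) by have [] := mu i.
have lr i : (\int[area]_x (`|complex.Re (u x i 0)| `^ m)%:E <= (A `^ m)%:E)%E.
  by apply: (le_m (fun x => complex.Re (u x i 0))) => // x; exact: Re_le_cvnorm.
have li i : (\int[area]_x (`|complex.Im (u x i 0)| `^ m)%:E <= (A `^ m)%:E)%E.
  by apply: (le_m (fun x => complex.Im (u x i 0))) => // x; exact: Im_le_cvnorm.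
have mwt (F : plane -> R) : measurable_fun setT F ->
    measurable_fun setT (fun xi => (w xi * F xi ^+ 2)%:E).
  move=> mF; apply/measurable_EFinP; apply: measurable_funM => //.
  exact: measurable_funX.
have mCr i := mwt _ (measurable_cos_transform (mr i)).
have mCi i := mwt _ (measurable_cos_transform (mi i)).
have mSr i := mwt _ (measurable_sin_transform (mr i)).
have mSi i := mwt _ (measurable_sin_transform (mi i)).
have bCr i : (\int[area]_xi (w xi * Cr i xi ^+ 2)%:E <= B%:E)%E.
  exact: (multiplier_scalar (or_introl erefl) (Lp1_integrable_Re i uL) mw w0 al0
    be0 wal wbe m1 m2 A0 (lr i)).
have bCi i : (\int[area]_xi (w xi * Ci i xi ^+ 2)%:E <= B%:E)%E.
  exact: (multiplier_scalar (or_introl erefl) (Lp1_integrable_Im i uL) mw w0 al0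
    be0 wal wbe m1 m2 A0 (li i)).
have bSr i : (\int[area]_xi (w xi * Sr i xi ^+ 2)%:E <= B%:E)%E.
  exact: (multiplier_scalar (or_intror erefl) (Lp1_integrable_Re i uL) mw w0 al0
    be0 wal wbe m1 m2 A0 (lr i)).
have bSi i : (\int[area]_xi (w xi * Si i xi ^+ 2)%:E <= B%:E)%E.
  exact: (multiplier_scalar (or_intror erefl) (Lp1_integrable_Im i uL) mw w0 al0
    be0 wal wbe m1 m2 A0 (li i)).
have wF0 (F : plane -> R) xi : (0 <= (w xi * F xi ^+ 2)%:E)%E.
  by rewrite lee_fin mulr_ge0// sqr_ge0.
pose G i xi := ((w xi * Cr i xi ^+ 2)%:E + (w xi * Si i xi ^+ 2)%:E +
   ((w xi * Ci i xi ^+ 2)%:E + (w xi * Sr i xi ^+ 2)%:E))%E.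
have G0 i xi : (0 <= G i xi)%E by rewrite !adde_ge0.
have mG i : measurable_fun setT (G i).
  apply: emeasurable_funD; apply: emeasurable_funD.
  - exact: mCr.
  - exact: mSi.
  - exact: mCi.
  - exact: mSr.
have iG i : (\int[area]_xi G i xi <= (B + B + (B + B))%:E)%E.
  have mCS : measurable_fun setT
      (fun xi => (w xi * Cr i xi ^+ 2)%:E + (w xi * Si i xi ^+ 2)%:E)%E.
    by apply: emeasurable_funD; [exact: mCr|exact: mSi].
  have mCS' : measurable_fun setT
      (fun xi => (w xi * Ci i xi ^+ 2)%:E + (w xi * Sr i xi ^+ 2)%:E)%E.
    by apply: emeasurable_funD; [exact: mCi|exact: mSr].
  rewrite ge0_integralD//; last 2 first.
  - by move=> xi _; rewrite adde_ge0.
  - by move=> xi _; rewrite adde_ge0.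
  rewrite !ge0_integralD//; last 4 first.
  - exact: mCi.
  - exact: mSr.
  - exact: mCr.
  - exact: mSi.
  rewrite [leRHS](_ : _ = (B%:E + B%:E) + (B%:E + B%:E))%E; last by rewrite !EFinD.
  by rewrite leeD// leeD.
apply: (@le_trans _ _ (\int[area]_xi (2%:E * \sum_(i < 4) G i xi))%E).
  apply: ge0_le_integral => //.
  - by move=> xi _; rewrite lee_fin mulr_ge0// sqr_ge0.
  - apply/measurable_EFinP; apply: measurable_funM => //; apply: measurable_funX.
    exact: (measurable_cvnorm (vmeasurable_fourier uL)).
  - by apply: measurable_funeM; exact: emeasurable_sum.
  - move=> xi _; rewrite /G.
    under eq_bigr do rewrite -!EFinD.
    rewrite sumEFin -EFinM lee_fin.
    apply: (le_trans (ler_wpM2l (w0 xi) (cvnorm_fourier_sqr_le xi uL))).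
    rewrite !mulr_sumr; apply: ler_sum => i _.
    by rewrite -/(Cr i xi) -/(Ci i xi) -/(Sr i xi) -/(Si i xi); lra.
rewrite ge0_integralZl//; last 2 first.
- exact: emeasurable_sum.
- by move=> xi _; exact: sume_ge0.
rewrite ge0_integral_sum//.
apply: (@le_trans _ _ (2%:E * \sum_(i < 4) (B + B + (B + B))%:E)%E).
  by rewrite lee_wpmul2l//; apply: lee_sum => i _; exact: iG.
rewrite sumEFin -EFinM lee_fin sumr_const card_ord /B -mulr_natl.
by rewrite le_eqVlt; apply/orP; left; apply/eqP; ring.
Qed.

End VectorFourier.

(** * From the conjugate exponent to weighted L^2 *)

Section Limit.
Context {R : realType}.
Local Notation plane := (measurableTypeR R * measurableTypeR R)%type.
Implicit Types (u g h : R * R -> 'cV[R[i]]_4).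

Lemma hat_le1 (x : R) : hat x <= 1.
Proof. by rewrite /hat ge_max ler01 lerBlDr lerDl sqr_ge0. Qed.

Lemma hat2_ge0 (xi : plane) : 0 <= hat2 xi.
Proof. by rewrite mulr_ge0// hat_ge0. Qed.

Lemma hat2_le1 (xi : plane) : hat2 xi <= 1.
Proof. by rewrite -[leRHS]mul1r ler_pM ?hat_ge0 ?hat_le1. Qed.

Lemma measurable_hat2 : measurable_fun setT (@hat2 R).
Proof. by apply/measurable_EFinP; exact: (measurable_int _ integrable_hat2). Qed.

Lemma integral_hat2_le : (\int[area]_xi (@hat2 R xi)%:E <= 256%:E)%E.
Proof.
(* The mass is the transform at frequency 0. *)
have -> : (\int[area]_xi (@hat2 R xi)%:E)%E =
    (\int[area]_xi (hat2 xi * cos (dotp ((0, 0) : plane) xi)))%:E.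
  rewrite fineK; last first.
    apply: integrable_fin_num => //; apply: integrable_hat2_kernel => [|xi].
      exact: (measurableT_comp measurable_cos_dotp (pair1_measurable ((0, 0) : plane))).
    exact: norm_cos_le1.
  by apply: eq_integral => xi _; rewrite /dotp /= !mul0r addr0 cos0 mulr1.
rewrite Rintegral_hat2_cos lee_fin /=.
apply: (le_trans (ler_norm _)).
apply: (le_trans (hat_fourier2_le ((0, 0) : plane))).
by rewrite /= /oneDsqr expr0n/= addr0 invr1 !mulr1.
Qed.

(** The first term suffices up to [de], the second beyond. Against a bounded weight of finite mass,
    a norm at most [de] in L^p thus gives a norm of order [de] in L^2. *)
Lemma sqr_le_powR (de p y : R) : 0 < de -> 2 <= p -> 0 <= y ->
  y ^+ 2 <= de ^+ 2 + de `^ (2 - p) * y `^ p.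
Proof.
move=> de0 p2 y0.
have hp : 0 <= de `^ (2 - p) * y `^ p by rewrite mulr_ge0// powR_ge0.
have [yde|dey] := leP y de.
  apply: (@le_trans _ _ (de ^+ 2)); last by rewrite lerDl.
  by rewrite lerXn2r ?nnegrE// ltW.
have yp : 0 < y by apply: lt_trans dey.
apply: (@le_trans _ _ (de `^ (2 - p) * y `^ p)); last by rewrite lerDr sqr_ge0.
have -> : y `^ p = y ^+ 2 * y `^ (p - 2).
  by rewrite -powR_mulrn// -powRD_gt0// [_%:R + _]addrC subrK.
have -> : de `^ (2 - p) = (de `^ (p - 2))^-1 by rewrite -powRN opprB.
rewrite mulrCA -[leLHS]mulr1 ler_wpM2l ?sqr_ge0//.
rewrite mulrC ler_pdivlMr ?powR_gt0// mul1r.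
by rewrite ge0_ler_powR ?nnegrE ?subr_ge0// ltW.
Qed.

(** The conjugate exponent is at least 2, so [sqr_le_powR] applies; [257] is the bound 256 for the
    mass of [hat2] plus 1 for the L^p term. For [m = 1] the norm is an essential supremum. *)
Lemma local_L2_small (m de : R) h : vmeasurable h -> 1 <= m -> m <= 2 -> 0 < de ->
  (Lp_norm (hoelder_conjugate m%:E) h <= de%:E)%E ->
  (\int[area]_xi (hat2 xi * cvnorm (h xi) ^+ 2)%:E <= (257 * de ^+ 2)%:E)%E.
Proof.
move=> mh m1 m2 de0.
have mcv := measurable_cvnorm mh.
have mhh : measurable_fun setT (fun xi : plane => (hat2 xi * cvnorm (h xi) ^+ 2)%:E).
  apply/measurable_EFinP; apply: measurable_funM; first exact: measurable_hat2.
  exact: measurable_funX.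
have H2 : (\int[area]_xi ((de ^+ 2)%:E * (@hat2 R xi)%:E) <= (256 * de ^+ 2)%:E)%E.
  rewrite (ge0_integralZl_real _ (sqr_ge0 _) measurable_hat2 hat2_ge0).
  rewrite (mulrC 256) [leRHS]EFinM; apply: lee_wpmul2l.
    by rewrite lee_fin sqr_ge0.
  exact: integral_hat2_le.
move: m1; rewrite le_eqVlt => /predU1P[<-|m1].
  rewrite hoelder_conjugate1 /Lp_norm unlock.
  case: ifPn => [_ /ess_sup_inf.ess_supP hle|].
    apply: (@le_trans _ _ (\int[area]_xi ((de ^+ 2)%:E * (@hat2 R xi)%:E))%E).
      apply: ae_ge0_le_integral => //.
      - by move=> xi _; rewrite lee_fin mulr_ge0 ?hat2_ge0// sqr_ge0.
      - by move=> xi _; rewrite -EFinM lee_fin mulr_ge0 ?hat2_ge0// sqr_ge0.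
      - apply: measurable_funeM; apply/measurable_EFinP; exact: measurable_hat2.
      - apply: filterS hle => xi /=; rewrite lee_fin ger0_norm ?cvnorm_ge0// => hx _.
        rewrite -EFinM lee_fin mulrC ler_wpM2r ?hat2_ge0// lerXn2r ?nnegrE ?cvnorm_ge0//.
        exact: ltW.
    apply: (le_trans H2); rewrite lee_fin ler_wpM2r ?sqr_ge0//; lra.
  (* On a space of measure zero this norm is 0 by convention, and the integral vanishes as well. *)
  rewrite -leNgt measure_le0 => /eqP T0 _.
  rewrite null_set_integral// lee_fin.
  by apply: mulr_ge0; [exact: ler0n|exact: sqr_ge0].
set p := m / (m - 1).
have -> : hoelder_conjugate m%:E = p%:E.
  rewrite /hoelder_conjugate/= eqe gt_eqF ?(lt_trans ltr01)//.
  by rewrite -EFinB inver subr_eq0 gt_eqF// -EFinM.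
have p2 : 2 <= p by rewrite /p ler_pdivlMr; lra.
move=> /(Lp_norm_le _ _ _).1 => h1.
have {h1} hp : (\int[area]_x (cvnorm (h x) `^ p)%:E <= (de `^ p)%:E)%E.
  by apply: h1; [lra|exact: ltW].
have mp : measurable_fun setT (fun x : plane => cvnorm (h x) `^ p).
  exact: (measurableT_comp (measurable_powR p) mcv).
apply: (@le_trans _ _ (\int[area]_xi ((de ^+ 2)%:E * (@hat2 R xi)%:E +
   (de `^ (2 - p))%:E * (cvnorm (h xi) `^ p)%:E))%E).
  apply: ge0_le_integral => //.
  - by move=> xi _; rewrite lee_fin mulr_ge0 ?hat2_ge0// sqr_ge0.
  - apply: emeasurable_funD; apply: measurable_funeM; apply/measurable_EFinP => //.
    exact: measurable_hat2.
  - move=> xi _; rewrite -!EFinM -EFinD lee_fin.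
    have := sqr_le_powR de0 p2 (cvnorm_ge0 (h xi)).
    move=> /(ler_wpM2l (hat2_ge0 xi)) hh; apply: (le_trans hh).
    rewrite mulrDr (mulrC (hat2 xi)) lerD2l -[leRHS]mul1r.
    by rewrite ler_wpM2r ?hat2_le1// mulr_ge0// powR_ge0.
rewrite ge0_integralD//; last 4 first.
- by move=> xi _; rewrite -EFinM lee_fin mulr_ge0 ?hat2_ge0// sqr_ge0.
- by apply: measurable_funeM; apply/measurable_EFinP; exact: measurable_hat2.
- by move=> xi _; rewrite -EFinM lee_fin mulr_ge0// powR_ge0.
- by apply: measurable_funeM; exact/measurable_EFinP.
have -> : (257 * de ^+ 2)%:E = ((256 * de ^+ 2)%:E + (de ^+ 2)%:E)%E.
  by rewrite -EFinD; congr EFin; ring.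
apply: leeD => //.
rewrite (ge0_integralZl_real _ (powR_ge0 _ _) mp) => [|x]; last exact: powR_ge0.
apply: (@le_trans _ _ ((de `^ (2 - p))%:E * (de `^ p)%:E)%E).
  by rewrite lee_wpmul2l// lee_fin powR_ge0.
by rewrite -EFinM -powRD_gt0// subrK powR_mulrn// ltW.
Qed.

End Limit.

(** * The multiplier estimate for data in L^m *)

Section FourierMultiplier.
Context {R : realType}.
Local Notation plane := (measurableTypeR R * measurableTypeR R)%type.
Implicit Types (f g : R * R -> 'cV[R[i]]_4).

Lemma cvge0_near_le (x : nat -> \bar R) (e : R) : 0 < e ->
  x n @[n --> \oo] --> 0%E -> \forall n \near \oo, (x n <= e%:E)%E.
Proof.
move=> e0 /fine_cvgP[xfin /cvgr_le xe].
have := xe _ e0; move: xfin; apply: filterS2 => n xn.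
by rewrite -lee_fin fineK.
Qed.

Lemma cvnormN (v : 'cV[R[i]]_4) : cvnorm (- v) = cvnorm v.
Proof.
rewrite /cvnorm; congr Num.sqrt; apply: eq_bigr => i _.
by rewrite mxE; case: (v i 0) => a b /=; rewrite !sqrrN.
Qed.

(** No limit of integrals is taken: a single approximant within [A] of [f], whose transform is
    within [de] of [g], already gives an error of the size of the main term. *)
Lemma fourier_multiplier : exists2 K : R, 0 < K &
  forall (m : R) f g (w : plane -> R) (al be A : R),
  1 <= m -> m <= 2 -> in_Lp m%:E f -> is_fourier m f g ->
  measurable_fun setT w -> (forall xi, 0 <= w xi) ->
  0 <= al -> 0 < be -> (forall xi, w xi <= al * hat2 xi) ->
  (\int[area]_xi (w xi)%:E <= (al * be)%:E)%E ->
  0 < A -> (Lp_norm m%:E f <= A%:E)%E ->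
  (\int[area]_xi (w xi * cvnorm (g xi) ^+ 2)%:E
    <= (K * (al * be `^ ((2 - m) / m) * A ^+ 2))%:E)%E.
Proof.
(* [8192 = 2 * 64 * 8 ^ 2] comes from the approximant, of norm at most [8 A], and [514 = 2 * 257]
   from the distance of its transform to [g]. *)
exists (8192 * (1 + 256 * pi ^+ 2) + 514).
  by have := sqr_ge0 (@pi R); lra.
move=> m f g w al be A.
move=> m1 m2 [mf _] [mg [u [uL1 uLm uf ug]]] mw w0 al0 be0 wal wbe A0 fA.
have m0 : 0 < m by lra.
set be' := be `^ ((2 - m) / m).
have be'0 : 0 < be' by rewrite powR_gt0.
(* Chosen so that [de ^ 2] is the factor [be' * A ^ 2] of the claimed bound. *)
pose de := Num.sqrt be' * A.
have de0 : 0 < de by rewrite mulr_gt0// sqrtr_gt0.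
have de2 : de ^+ 2 = be' * A ^+ 2 by rewrite exprMn sqr_sqrtr// ltW.
have [n [unf ung]] : exists n, (Lp_norm m%:E (fun x => u n x - f x)%R <= A%:E)%E /\
   (Lp_norm (hoelder_conjugate m%:E) (fun xi => fourier_L1 (u n) xi - g xi)%R <= de%:E)%E.
  have c1 := cvge0_near_le A0 uf; have c2 := cvge0_near_le de0 ug.
  by near \oo => n; exists n; split; near: n.
have [mun _] := uL1 n.
have mun' := vmeasurable_fourier (uL1 n).
have md1 := vmeasurableB mun mf; have md2 := vmeasurableB mun' mg.
have mpow h : vmeasurable h ->
    measurable_fun setT (fun x : plane => cvnorm (h x) `^ m).
  by move=> mh; exact: (measurableT_comp (measurable_powR m) (measurable_cvnorm mh)).
have pow0 (h : R * R -> 'cV[R[i]]_4) (x : plane) : (0 <= (cvnorm (h x) `^ m)%:E)%E.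
  by rewrite lee_fin powR_ge0.
(* [4 (A ^ m + A ^ m) <= (8 A) ^ m], as [m >= 1]. *)
have unA : (\int[area]_x (cvnorm (u n x) `^ m)%:E <= ((8 * A) `^ m)%:E)%E.
  apply: (@le_trans _ _ (\int[area]_x (4%:E * ((cvnorm (u n x - f x) `^ m)%:E +
     (cvnorm (f x) `^ m)%:E)))%E).
    apply: ge0_le_integral => //.
    - by apply/measurable_EFinP; exact: mpow.
    - apply: measurable_funeM; apply: emeasurable_funD; apply/measurable_EFinP.
        exact: (mpow _ md1).
      exact: mpow.
    - move=> x _; rewrite -EFinD -EFinM lee_fin.
      have := @cvnorm_powRD R m (u n x - f x) (f x).
      by rewrite subrK; apply; lra.
  rewrite ge0_integralZl//; last 2 first.
  - apply: emeasurable_funD; apply/measurable_EFinP; first exact: (mpow _ md1).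
    exact: mpow.
  - by move=> x _; rewrite -EFinD lee_fin addr_ge0// powR_ge0.
  rewrite ge0_integralD//; last 3 first.
  - by move=> x _; rewrite lee_fin powR_ge0.
  - by apply/measurable_EFinP; exact: (mpow _ md1).
  - by apply/measurable_EFinP; exact: mpow.
  apply: (@le_trans _ _ (4%:E * ((A `^ m)%:E + (A `^ m)%:E))%E).
    rewrite lee_wpmul2l//; apply: leeD.
      by apply: (Lp_norm_le (fun x => u n x - f x) m0 (ltW A0)).1.
    by apply: (Lp_norm_le f m0 (ltW A0)).1.
  rewrite -EFinD -EFinM lee_fin powRM//; last exact: ltW.
  have h8 : 8 <= 8 `^ m :> R by rewrite -[leLHS]powRr1// ler_powR// ler1n.
  have := powR_ge0 A m; nra.
have A80 : 0 < 8 * A by lra.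
have E1 := multiplier_vector (uL1 n) mw w0 al0 be0 wal wbe m1 m2 A80 unA.
rewrite -/be' in E1.
have E2 := local_L2_small md2 m1 m2 de0 ung.
have mw2 h : vmeasurable h ->
    measurable_fun setT (fun xi : plane => w xi * cvnorm (h xi) ^+ 2).
  move=> mh; apply: measurable_funM => //; apply: measurable_funX.
  exact: measurable_cvnorm.
have w20 (h : R * R -> 'cV[R[i]]_4) (xi : plane) : 0 <= w xi * cvnorm (h xi) ^+ 2.
  by rewrite mulr_ge0// sqr_ge0.
have mh2 : measurable_fun setT
    (fun xi : plane => hat2 xi * cvnorm (fourier_L1 (u n) xi - g xi) ^+ 2).
  apply: measurable_funM; first exact: measurable_hat2.
  by apply: measurable_funX; exact: (measurable_cvnorm md2).
have h20 (xi : plane) : 0 <= hat2 xi * cvnorm (fourier_L1 (u n) xi - g xi) ^+ 2.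
  by rewrite mulr_ge0 ?hat2_ge0// sqr_ge0.
apply: (@le_trans _ _ (\int[area]_xi (2%:E * (w xi * cvnorm (fourier_L1 (u n) xi) ^+ 2)%:E +
   (2 * al)%:E * (hat2 xi * cvnorm (fourier_L1 (u n) xi - g xi) ^+ 2)%:E))%E).
  apply: ge0_le_integral => //.
  - by move=> xi _; rewrite lee_fin.
  - by apply/measurable_EFinP; exact: mw2.
  - apply: emeasurable_funD; apply: measurable_funeM; apply/measurable_EFinP => //.
    exact: mw2.
  - move=> xi _; rewrite -!EFinM -EFinD lee_fin.
    have := cvnorm_sqrD (fourier_L1 (u n) xi) (g xi - fourier_L1 (u n) xi).
    rewrite [X in cvnorm X](addrC (fourier_L1 (u n) xi)) subrK.
    have -> : cvnorm (g xi - fourier_L1 (u n) xi) = cvnorm (fourier_L1 (u n) xi - g xi).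
      by rewrite -opprB cvnormN.
    move=> /(ler_wpM2l (w0 xi)).
    have := ler_wpM2r (sqr_ge0 (cvnorm (fourier_L1 (u n) xi - g xi))) (wal xi).
    lra.
rewrite ge0_integralD//; last 4 first.
- by move=> xi _; rewrite -EFinM lee_fin mulr_ge0.
- by apply: measurable_funeM; apply/measurable_EFinP; exact: mw2.
- by move=> xi _; rewrite -EFinM lee_fin mulr_ge0// mulr_ge0.
- by apply: measurable_funeM; exact/measurable_EFinP.
have al20 : 0 <= 2 * al by rewrite mulr_ge0.
rewrite (ge0_integralZl_real _ _ (mw2 _ mun') (w20 _))//.
rewrite (ge0_integralZl_real _ al20 mh2 h20).
apply: (@le_trans _ _ (2%:E * (64 * (1 + 256 * pi ^+ 2) * al * be' * (8 * A) ^+ 2)%:E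
   + (2 * al)%:E * (257 * de ^+ 2)%:E)%E).
  by apply: leeD; apply: lee_wpmul2l; rewrite // lee_fin.
rewrite -!EFinM -EFinD lee_fin de2 le_eqVlt; apply/orP; left; apply/eqP; ring.
Unshelve. all: by end_near.
Qed.

End FourierMultiplier.

(** * The Cauchy envelope of the multiplier *)

Section Weight.
Context {R : realType}.
Local Notation plane := (measurableTypeR R * measurableTypeR R)%type.

(** In the variable [z = y ^ k] the power is at most 1 for [z <= 1]; beyond, it is at most
    [z ^ (n + 1)], a multiple of a term of the exponential series. *)
Lemma powR_le_expR (ga c k : R) : 0 <= ga -> 0 < c -> 0 < k ->
  exists2 C : R, 0 < C & forall y, 0 <= y -> y `^ ga <= C * expR (c * y `^ k).
Proof.
move=> ga0 c0 k0.
have [n gan] : exists n : nat, ga / k <= n.+1%:R.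
  have /archi_boundP h : 0 <= ga / k by rewrite divr_ge0// ltW.
  exists (Num.bound (ga / k)); apply: (le_trans (ltW h)).
  by rewrite ler_nat.
have f0 : 0 < n.+1`!%:R :> R by rewrite ltr0n fact_gt0.
have cn0 : 0 < c ^+ n.+1 by rewrite exprn_gt0.
exists (1 + n.+1`!%:R / c ^+ n.+1).
  by rewrite addr_gt0// divr_gt0.
move=> y y0; set z := y `^ k.
have z0 : 0 <= z by exact: powR_ge0.
have cz0 : 0 <= c * z by rewrite mulr_ge0// ltW.
have e1 : 1 <= expR (c * z) by apply: le_trans (expR_ge1Dx _); rewrite lerDl.
have zn : z ^+ n.+1 <= n.+1`!%:R / c ^+ n.+1 * expR (c * z).
  have := expR_ge1Dxn n cz0; rewrite exprMn => h.
  rewrite mulrAC ler_pdivlMr// -ler_pdivrMl//.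
  by apply: le_trans h; rewrite mulrC (mulrC (z ^+ _)) lerDr.
have -> : y `^ ga = z `^ (ga / k).
  by rewrite /z -powRrM mulrCA divff ?mulr1// gt_eqF.
rewrite mulrDl mul1r.
have [z1|z1] := leP z 1.
  apply: (@le_trans _ _ 1).
    have -> : 1 = 1 `^ (ga / k) :> R by rewrite powR1.
    by rewrite ge0_ler_powR ?nnegrE// divr_ge0// ltW.
  apply: (le_trans e1); rewrite lerDl mulr_ge0 ?expR_ge0// divr_ge0//; exact: ltW.
apply: (@le_trans _ _ (z ^+ n.+1)).
  by rewrite -powR_mulrn// ler_powR// ltW.
by apply: (le_trans zn); rewrite lerDr expR_ge0.
Qed.

(** After rescaling, the multiplier is a fixed radial profile; the factor [(1 + y ^ 2) ^ 2]
    majorises the product of the two denominators of [cauchy2]. *)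
Lemma radial_weight (si c k : R) : 0 <= si -> 0 < c -> 0 < k ->
  exists2 C : R, 0 < C & forall y, 0 <= y ->
    (y `^ si * expR (- (c * y `^ k))) ^+ 2 * (1 + y ^+ 2) ^+ 2 <= C.
Proof.
move=> si0 c0 k0.
have si20 : 0 <= si * 2 by rewrite mulr_ge0.
have c20 : 0 < c * 2 by rewrite mulr_gt0.
have [C1 C10 h1] := powR_le_expR si20 c20 k0.
have [C2 C20 h2] : exists2 C, 0 < C & forall y, 0 <= y ->
    y `^ (si * 2 + 4) <= C * expR (c * 2 * y `^ k).
  by apply: powR_le_expR => //; rewrite addr_ge0.
exists (2 * (C1 + C2)); first by rewrite mulr_gt0// addr_gt0.
move=> y y0.
have -> : (y `^ si * expR (- (c * y `^ k))) ^+ 2 =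
    y `^ (si * 2) * expR (- (c * 2 * y `^ k)).
  rewrite exprMn -expRM_natl powRrM powR_mulrn ?powR_ge0//.
  by congr (_ * expR _); ring.
have E := expR_gt0 (c * 2 * y `^ k).
rewrite expRN mulrAC ler_pdivrMr//.
apply: (@le_trans _ _ (y `^ (si * 2) * (2 * (1 + y ^+ 4)))).
  rewrite ler_wpM2l ?powR_ge0//.
  have := sqr_ge0 (1 - y ^+ 2); rewrite (_ : y ^+ 4 = y ^+ 2 ^+ 2) ?sqrrB ?sqrrD; last by rewrite -exprM.
  lra.
have := h1 _ y0; have := h2 _ y0.
have CE : 0 <= C2 * expR (c * 2 * y `^ k) by rewrite mulr_ge0// ltW.
move: y0 CE; rewrite le_eqVlt => /predU1P[<-|y0] CE.
  by rewrite expr0n/= addr0; lra.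
by rewrite powRD_gt0// [_ `^ 4]powR_mulrn ?(ltW y0)//; lra.
Qed.

(** This square contains the disc of radius [1/2], and [hat2] is at least [1/2] on it. *)
Definition box (xi : plane) : bool := (`|xi.1| <= 2^-1) && (`|xi.2| <= 2^-1).

Definition weight (B T : R) (xi : plane) : R :=
  if box xi then B * cauchy2 T (0, 0) xi else 0.

Lemma weight_ge0 B T xi : 0 <= B -> 0 <= weight B T xi.
Proof. by move=> B0; rewrite /weight; case: ifP => // _; rewrite mulr_ge0// cauchy2_ge0. Qed.

Lemma measurable_weight B T : measurable_fun setT (weight B T).
Proof.
apply: measurable_fun_ifT => //.
  apply: measurable_and; apply: measurable_fun_ler => //;
    apply: measurableT_comp => //.
by apply: measurable_funM => //; exact: measurable_cauchy2.
Qed.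

Lemma box_hat2 xi : box xi -> 1 <= 2 * hat2 xi.
Proof.
move=> /andP[]; rewrite !ler_norml => /andP[h1 h2] /andP[h3 h4].
have a1 : 3 / 4 <= hat xi.1 by rewrite /hat le_max; apply/orP; right; nra.
have a2 : 3 / 4 <= hat xi.2 by rewrite /hat le_max; apply/orP; right; nra.
by rewrite /hat2; nra.
Qed.

Lemma cauchy2_le1 T x y : cauchy2 T x y <= 1 :> R.
Proof.
by rewrite -[leRHS]mul1r ler_pM// ?invr_ge0 ?invf_le1 ?(lt_le_trans ltr01)
  ?(le_trans ler01)// oneDsqr_ge1.
Qed.

(** The 2 is due to [hat2 >= 1/2] on [box], the [pi ^ 2] to the mass of the Cauchy kernel: their sum
    serves here and in [integral_weight_le], since [fourier_multiplier] takes one [al] for both. *)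
Lemma weight_le B T xi : 0 <= B -> weight B T xi <= (2 + pi ^+ 2) * B * hat2 xi.
Proof.
move=> B0; have h0 : 0 <= hat2 xi by rewrite mulr_ge0// hat_ge0.
have p0 : 0 <= pi ^+ 2 * B * hat2 xi by rewrite mulr_ge0// mulr_ge0// sqr_ge0.
rewrite /weight; case: ifPn => [bx|_]; last by have := mulr_ge0 B0 h0; lra.
have := ler_wpM2l B0 (cauchy2_le1 T (0, 0) xi).
have := ler_wpM2l B0 (box_hat2 bx); lra.
Qed.

Lemma integral_weight_le B T : 0 <= B -> 0 < T ->
  (\int[area]_xi (weight B T xi)%:E <= ((2 + pi ^+ 2) * B * T ^- 2)%:E)%E.
Proof.
move=> B0 T0.
apply: (@le_trans _ _ (\int[area]_xi (B%:E * (cauchy2 T (0, 0) xi)%:E))%E).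
  apply: ge0_le_integral => //.
  - by move=> xi _; rewrite lee_fin weight_ge0.
  - by apply/measurable_EFinP; exact: measurable_weight.
  - by apply: measurable_funeM; apply/measurable_EFinP; exact: measurable_cauchy2.
  - move=> xi _; rewrite -EFinM lee_fin /weight; case: ifP => // _.
    by rewrite mulr_ge0// cauchy2_ge0.
rewrite (ge0_integralZl_real _ B0 (measurable_cauchy2 T (0, 0)) (cauchy2_ge0 T (0, 0))).
rewrite integral_cauchy2// -EFinM lee_fin exprMn exprVn.
have : 0 <= B * T ^- 2 by rewrite mulr_ge0// invr_ge0 sqr_ge0.
lra.
Qed.

(** With [T = (1 + t) ^ (1 / k)] and [y = r * T], [r] being the Euclidean norm of [xi], one has
    [r ^ k * (1 + t) = y ^ k]. So the multiplier is at most [expR c * T ^ (- si)] times the profile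
    of [radial_weight] at [y]; the factor [expR c] pays for replacing [t] by [1 + t], as
    [r <= 1]. *)
Lemma weight_dominates (si c k : R) : 0 <= si -> 0 < c -> 0 < k ->
  exists2 C : R, 0 < C & forall t xi, 0 <= t -> enorm xi <= 2^-1 ->
    (enorm xi `^ si * expR (- (c * enorm xi `^ k * t))) ^+ 2 <=
    weight (C * (1 + t) `^ (- (2 * si / k))) ((1 + t) `^ k^-1) xi.
Proof.
move=> si0 c0 k0; have [C0 C00 h0] := radial_weight si0 c0 k0.
exists (C0 * expR (2 * c)); first by rewrite mulr_gt0// expR_gt0.
move=> t xi t0 r2; set r := enorm xi in r2 *; set T := (1 + t) `^ k^-1.
have r0 : 0 <= r by exact: sqrtr_ge0.
have rE : r ^+ 2 = xi.1 ^+ 2 + xi.2 ^+ 2.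
  by rewrite sqr_sqrtr// addr_ge0// sqr_ge0.
have t10 : 0 < 1 + t by lra.
have T0 : 0 < T by rewrite powR_gt0.
have bx : box xi.
  apply/andP; split; rewrite -ler_sqr ?nnegrE// real_normK ?num_real//.
    by have := sqr_ge0 xi.2; nra.
  by have := sqr_ge0 xi.1; nra.
rewrite /weight bx.
pose y := r * T.
have y0 : 0 <= y by rewrite mulr_ge0// ltW.
have yk : y `^ k = r `^ k * (1 + t).
  by rewrite powRM ?(ltW T0)// -powRrM mulVf ?gt_eqF// powRr1// ltW.
have -> : (1 + t) `^ (- (2 * si / k)) = ((T `^ si) ^+ 2)^-1.
  rewrite powRN -powR_mulrn ?powR_ge0// -!powRrM; congr ((_ `^ _)^-1).
  by field; rewrite gt_eqF.
have Ts : 0 < T `^ si by rewrite powR_gt0.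
have e1 : expR (- (c * r `^ k * t)) <= expR c * expR (- (c * y `^ k)).
  rewrite -expRD ler_expR yk.
  have : r `^ k <= 1.
    have -> : 1 = 1 `^ k :> R by rewrite powR1.
    by rewrite ge0_ler_powR ?nnegrE//; lra.
  by move=> /(ler_wpM2l (ltW c0)); lra.
have ys : y `^ si = r `^ si * T `^ si by rewrite powRM// ltW.
have q1 : 0 < oneDsqr (T * (xi.1 - 0)) by rewrite (lt_le_trans ltr01)// oneDsqr_ge1.
have q2 : 0 < oneDsqr (T * (xi.2 - 0)) by rewrite (lt_le_trans ltr01)// oneDsqr_ge1.
have q12 : oneDsqr (T * (xi.1 - 0)) * oneDsqr (T * (xi.2 - 0)) <= (1 + y ^+ 2) ^+ 2.
  have -> : y ^+ 2 = T ^+ 2 * xi.1 ^+ 2 + T ^+ 2 * xi.2 ^+ 2.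
    by rewrite /y exprMn rE; ring.
  rewrite /oneDsqr !subr0 !exprMn expr2.
  have z1 : 0 <= T ^+ 2 * xi.1 ^+ 2 by rewrite mulr_ge0// sqr_ge0.
  have z2 : 0 <= T ^+ 2 * xi.2 ^+ 2 by rewrite mulr_ge0// sqr_ge0.
  by apply: ler_pM; lra.
rewrite /cauchy2 /= -invfM.
rewrite ler_pdivlMr ?mulr_gt0//.
apply: (@le_trans _ _ ((r `^ si * expR (- (c * r `^ k * t))) ^+ 2 * (1 + y ^+ 2) ^+ 2)).
  by rewrite ler_wpM2l// sqr_ge0.
rewrite ler_pdivlMr ?exprn_gt0//.
have := h0 y y0; rewrite ys => h.
have -> : (r `^ si * expR (- (c * r `^ k * t))) ^+ 2 * (1 + y ^+ 2) ^+ 2 *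
    (T `^ si) ^+ 2 = (r `^ si * T `^ si) ^+ 2 * (1 + y ^+ 2) ^+ 2 *
    expR (- (c * r `^ k * t)) ^+ 2 by ring.
have -> : expR (2 * c) = expR c ^+ 2 by rewrite expRM_natl.
apply: (@le_trans _ _ ((r `^ si * T `^ si) ^+ 2 * (1 + y ^+ 2) ^+ 2 *
    (expR c * expR (- (c * y `^ k))) ^+ 2)).
  apply: ler_wpM2l; first by rewrite mulr_ge0 ?sqr_ge0.
  by rewrite lerXn2r// nnegrE ?mulr_ge0// expR_ge0.
have -> : (r `^ si * T `^ si) ^+ 2 * (1 + y ^+ 2) ^+ 2 *
    (expR c * expR (- (c * y `^ k))) ^+ 2 =
    (r `^ si * T `^ si * expR (- (c * y `^ k))) ^+ 2 * (1 + y ^+ 2) ^+ 2 *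
    expR c ^+ 2 by ring.
by rewrite ler_wpM2r// sqr_ge0.
Qed.

End Weight.

(** * The symbols on coupled pairs of components *)

Section Rows.
Context {R : realType}.
Implicit Types (v : 'cV[R[i]]_4) (xi : R * R).

(* The components of index [j] and [j + 2] of a vector of C^4 are coupled by [B0]. *)
Definition lo (j : 'I_2) : 'I_4 := lshift 2 j.
Definition hi (j : 'I_2) : 'I_4 := rshift 2 j.
Definition speed (a b : R) (j : 'I_2) : R := if j == ord0 then b else a.

Lemma ord4_lo_hi (i : 'I_4) : exists j : 'I_2, i = lo j \/ i = hi j.
Proof.
case: (@splitP 2 2 i) => j ij; exists j.
  by left; exact: val_inj.
by right; exact: val_inj.
Qed.

Lemma sum4 (V : nmodType) (F : 'I_4 -> V) :
  \sum_i F i = F (lo ord0) + F (lo ord_max) + (F (hi ord0) + F (hi ord_max)).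
Proof.
rewrite (@big_split_ord _ _ _ 2 2) /= !big_ord_recl !big_ord0 !addr0.
by rewrite (_ : lift ord0 ord0 = ord_max)//; exact: val_inj.
Qed.

Lemma ord2P (P : 'I_2 -> Prop) : P ord0 -> P ord_max -> forall j, P j.
Proof.
move=> P0 P1; case=> -[|[|//]] h.
  by rewrite (_ : Ordinal h = ord0)//; exact: val_inj.
by rewrite (_ : Ordinal h = ord_max)//; exact: val_inj.
Qed.

Lemma B0_entry (i k : 'I_4) (j j' : 'I_2) :
  (i = lo j \/ i = hi j) -> (k = lo j' \/ k = hi j') ->
  @B0 R i k = (j == j')%:R.
Proof.
by move=> [->|->] [->|->]; rewrite mxE; move: j j'; apply: ord2P; apply: ord2P.
Qed.

Lemma T1_lo_lo j j' : @T1 R (lo j) (lo j') = - (j == j')%:R.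
Proof. by rewrite mxE; move: j j'; apply: ord2P; apply: ord2P => /=; rewrite ?oppr0. Qed.

Lemma T1_entry (i k : 'I_4) (j j' : 'I_2) :
  (i = hi j \/ i = lo j /\ k = hi j') -> (k = lo j' \/ k = hi j') ->
  @T1 R i k = (j == j')%:R.
Proof.
move=> [->|[-> ->]]; last first.
  by move=> _; rewrite mxE; move: j j'; apply: ord2P; apply: ord2P.
by move=> [->|->]; rewrite mxE; move: j j'; apply: ord2P; apply: ord2P.
Qed.

Lemma diag4_mul (d : seq R) v (i : 'I_4) : (diag4 d *m v) i 0 = (d`_i)%:C * v i 0.
Proof. by rewrite /diag4 mul_diag_mx !mxE. Qed.

Lemma B0_mul v (i : 'I_4) j : (i = lo j \/ i = hi j) ->
  (@B0 R *m v) i 0 = v (lo j) 0 + v (hi j) 0.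
Proof.
move=> ij; rewrite mxE sum4.
rewrite !(B0_entry (j := j) ij (or_introl erefl)) !(B0_entry (j := j) ij (or_intror erefl)).
by move: j {ij}; apply: ord2P; rewrite /= !(mul1r, mul0r, addr0, add0r).
Qed.

Lemma T1_mul_lo v j : (@T1 R *m v) (lo j) 0 = - v (lo j) 0 + v (hi j) 0.
Proof.
rewrite mxE sum4 !T1_lo_lo.
rewrite !(T1_entry (j := j) (or_intror (conj erefl erefl)) (or_intror erefl)).
by move: j; apply: ord2P; rewrite /= !(mulN1r, oppr0, mul1r, mul0r, addr0, add0r).
Qed.

Lemma T1_mul_hi v j : (@T1 R *m v) (hi j) 0 = v (lo j) 0 + v (hi j) 0.
Proof.
rewrite mxE sum4.
rewrite !(T1_entry (j := j) (or_introl erefl) (or_introl erefl)).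
rewrite !(T1_entry (j := j) (or_introl erefl) (or_intror erefl)).
by move: j; apply: ord2P; rewrite /= !(mul1r, mul0r, addr0, add0r).
Qed.

Lemma Re_scale (k : R) (z : R[i]) : complex.Re (k%:C * z) = k * complex.Re z.
Proof. by case: z => x y /=; rewrite mul0r subr0. Qed.

Lemma Im_scale (k : R) (z : R[i]) : complex.Im (k%:C * z) = k * complex.Im z.
Proof. by case: z => x y /=; rewrite mul0r addr0. Qed.

Lemma Re_iM (z : R[i]) : complex.Re ('i%C * z) = - complex.Im z.
Proof. by case: z => x y /=; rewrite mul0r mul1r sub0r. Qed.

Lemma Im_iM (z : R[i]) : complex.Im ('i%C * z) = complex.Re z.
Proof. by case: z => x y /=; rewrite mul0r mul1r add0r. Qed.

Lemma ReN (z : R[i]) : complex.Re (- z) = - complex.Re z.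
Proof. by case: z. Qed.

Lemma ImN (z : R[i]) : complex.Im (- z) = - complex.Im z.
Proof. by case: z. Qed.

Lemma halfC : 2^-1 = (2^-1)%:C :> R[i].
Proof. by rewrite fmorphV rmorph_nat. Qed.

Definition ReIm := (@ReD R, @ImD R, ReN, ImN, Re_scale, Im_scale, Re_iM, Im_iM).

Lemma mulmx_scale (k : R[i]) (A : 'M[R[i]]_4) v (i : 'I_4) :
  (k *: A *m v) i 0 = k * (A *m v) i 0.
Proof. by rewrite -scalemxAl mxE. Qed.

Lemma mulmx_add (A B : 'M[R[i]]_4) v (i : 'I_4) :
  ((A + B) *m v) i 0 = (A *m v) i 0 + (B *m v) i 0.
Proof. by rewrite mulmxDl mxE. Qed.

Lemma mulmx_comb3 (k1 k2 k3 : R[i]) (A1 A2 A3 : 'M[R[i]]_4) v (i : 'I_4) :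
  ((k1 *: A1 + k2 *: A2 + k3 *: A3) *m v) i 0 =
  k1 * (A1 *m v) i 0 + k2 * (A2 *m v) i 0 + k3 * (A3 *m v) i 0.
Proof. by rewrite !mulmx_add !mulmx_scale. Qed.

Lemma mulmx_symbol (k1 k2 k3 h c : R[i]) (A B : 'M[R[i]]_4) v (i : 'I_4) :
  ((k1 *: (h *: A) + k2 *: (c *: B) + k3 *: (h *: A)) *m v) i 0 =
  k1 * (h * (A *m v) i 0) + k2 * (c * (B *m v) i 0) + k3 * (h * (A *m v) i 0).
Proof. by rewrite mulmx_comb3 !mulmx_scale. Qed.

Lemma mulmx_comb2 (k1 k2 : R[i]) (A1 A2 : 'M[R[i]]_4) v (i : 'I_4) :
  ((k1 *: A1 + k2 *: A2) *m v) i 0 = k1 * (A1 *m v) i 0 + k2 * (A2 *m v) i 0.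
Proof. by rewrite !mulmx_add !mulmx_scale. Qed.

Section SymbolRows.
Context (a b rho theta : R) (xi : R * R).
Let r := enorm xi.
Let l := r `^ (2 * rho) + r `^ (2 * theta).

Lemma symbol_row v (i : 'I_4) :
  (symbol a b rho theta xi *m v) i 0 =
  (r `^ (2 * rho))%:C * ((2^-1)%:C * (@B0 R *m v) i 0)
  + r%:C * ('i%C * ((nth 0 [:: - b; - a; b; a] i)%:C * v i 0))
  + (r `^ (2 * theta))%:C * ((2^-1)%:C * (@B0 R *m v) i 0).
Proof.
rewrite /symbol (mulmx_symbol (lap rho xi) (lap 2^-1 xi) (lap theta xi) 2^-1 'i%C
  (@B0 R) (B1 a b)) diag4_mul halfC.
by rewrite /lap (_ : 2 * 2^-1 = 1) ?mulfV// powRr1 ?sqrtr_ge0.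
Qed.

Lemma symbol_lo v j :
  (symbol a b rho theta xi *m v) (lo j) 0 =
  (l / 2)%:C * (v (lo j) 0 + v (hi j) 0)
  - (speed a b j * r)%:C * ('i%C * v (lo j) 0).
Proof.
rewrite symbol_row (B0_mul v (j := j) (or_introl erefl)).
have -> : nth 0 [:: - b; - a; b; a] (lo j) = - speed a b j.
  by move: j; apply: ord2P.
by rewrite /l !(rmorphM, rmorphD, rmorphN) /=; ring.
Qed.

Lemma symbol_hi v j :
  (symbol a b rho theta xi *m v) (hi j) 0 =
  (l / 2)%:C * (v (lo j) 0 + v (hi j) 0)
  + (speed a b j * r)%:C * ('i%C * v (hi j) 0).
Proof.
rewrite symbol_row (B0_mul v (j := j) (or_intror erefl)).
have -> : nth 0 [:: - b; - a; b; a] (hi j) = speed a b j.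
  by move: j; apply: ord2P.
by rewrite /l !(rmorphM, rmorphD) /=; ring.
Qed.

Definition slow_rate j : R := speed a b j ^+ 2 * r `^ (2 * (1 - rho)).

(** In the second regime [1 - rho = theta], so the first two values are [l - slow_rate j]; the third
    lacks the term [|xi| ^ (2 theta)]. These are the two ends of the range allowed for [nu] in
    [two_mode_estimate]. *)
Definition fast_rate j : R :=
  if rho + theta < 1 then r `^ (2 * rho) + r `^ (2 * theta) - slow_rate j
  else if rho + theta == 1 then
    r `^ (2 * rho) + r `^ (2 * (1 - rho)) - slow_rate j
  else r `^ (2 * rho) - slow_rate j.

Let M1_lo j : nth 0 [:: b ^+ 2; a ^+ 2; - b ^+ 2; - a ^+ 2] (lo j) = speed a b j ^+ 2.
Proof. by move: j; apply: ord2P. Qed.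

Let M1_hi j : nth 0 [:: b ^+ 2; a ^+ 2; - b ^+ 2; - a ^+ 2] (hi j) = - speed a b j ^+ 2.
Proof. by move: j; apply: ord2P. Qed.

Let M2_lo j : nth 0 [:: 0; 0; 1; 1] (lo j) = 0 :> R.
Proof. by move: j; apply: ord2P. Qed.

Let M2_hi j : nth 0 [:: 0; 0; 1; 1] (hi j) = 1 :> R.
Proof. by move: j; apply: ord2P. Qed.

Lemma ref_symbol_lo v j :
  (ref_symbol a b rho theta xi *m v) (lo j) 0 = (slow_rate j)%:C * v (lo j) 0.
Proof.
rewrite /ref_symbol /slow_rate.
case: ifP => _; [|case: ifP => _].
- rewrite (mulmx_comb3 (lap (1 - rho) xi) (lap rho xi) (lap theta xi)).
  rewrite !diag4_mul M1_lo M2_lo /lap !rmorphM /=; ring.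
- rewrite (mulmx_comb2 (lap (1 - rho) xi) (lap rho xi)) (mulmx_add (M1 a b)).
  rewrite !diag4_mul M1_lo M2_lo /lap !rmorphM /=; ring.
- rewrite (mulmx_comb2 (lap (1 - rho) xi) (lap rho xi)).
  rewrite !diag4_mul M1_lo M2_lo /lap !rmorphM /=; ring.
Qed.

Lemma ref_symbol_hi v j :
  (ref_symbol a b rho theta xi *m v) (hi j) 0 = (fast_rate j)%:C * v (hi j) 0.
Proof.
rewrite /ref_symbol /fast_rate /slow_rate.
case: ifP => _; [|case: ifP => _].
- rewrite (mulmx_comb3 (lap (1 - rho) xi) (lap rho xi) (lap theta xi)).
  rewrite !diag4_mul M1_hi M2_hi /lap !(rmorphB, rmorphD, rmorphM) rmorphN /=; ring.
- rewrite (mulmx_comb2 (lap (1 - rho) xi) (lap rho xi)) (mulmx_add (M1 a b)).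
  rewrite !diag4_mul M1_hi M2_hi /lap !(rmorphB, rmorphD, rmorphM) rmorphN /=; ring.
- rewrite (mulmx_comb2 (lap (1 - rho) xi) (lap rho xi)).
  rewrite !diag4_mul M1_hi M2_hi /lap !(rmorphB, rmorphD, rmorphM) rmorphN /=; ring.
Qed.

End SymbolRows.

End Rows.

(** * The estimate at a fixed frequency *)

Section Pointwise.
Context {R : realType}.
Context (a b rho theta : R) (xi : R * R).
Hypotheses (ha : 0 < a) (hab : a < b) (hrho : rho < 2^-1)
  (htheta : 2^-1 < theta).
Let k0 : 0 < 1 - 2 * rho. Proof. by move: hrho; lra. Qed.
Let k1 : 0 < 2 * (1 - rho). Proof. by move: hrho; lra. Qed.
Let k2 : 1 <= 2 * theta. Proof. by move: htheta; lra. Qed.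
Let k3 : 0 < 2 * theta. Proof. by move: htheta; lra. Qed.
Let r := enorm xi.
Let e := r `^ (1 - 2 * rho).
Hypotheses (r1 : r <= 1) (be4 : b * e <= 4^-1).

Let r0 : 0 <= r. Proof. exact: sqrtr_ge0. Qed.
Let R1 := r `^ (2 * rho).
Let S := r `^ (2 * theta).

Let eR1 : e * R1 = r.
Proof.
(* At [xi = 0] the factor [e] is 0, its exponent being positive, whereas [R1] is 1 if [rho = 0]. *)
rewrite /e /R1; move: r0; rewrite le_eqVlt => /predU1P[<-|rp].
  by rewrite powR0 ?mul0r// gt_eqF.
by rewrite -powRD_gt0// subrK powRr1// ltW.
Qed.

Let eeR1 : e ^+ 2 * R1 = r `^ (2 * (1 - rho)).
Proof.
rewrite expr2 -mulrA eR1 /e; move: r0; rewrite le_eqVlt => /predU1P[<-|rp].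
  by rewrite mulr0 powR0// gt_eqF.
rewrite -{2}(powRr1 (ltW rp)) -powRD_gt0//; congr (_ `^ _); ring.
Qed.

(** As [2 theta >= 1] and [|xi| <= 1], the damping of order [theta] is at most [|xi| = e * R1]: an
    error of relative size [e]. *)
Let S_le : S <= e * R1.
Proof.
rewrite eR1 /S; move: r0; rewrite le_eqVlt => /predU1P[<-|rp].
  by rewrite powR0// gt_eqF.
rewrite -[leRHS]powRr1 ?(ltW rp)//; apply: ger_powR; first by rewrite rp.
exact: k2.
Qed.

Let e1 : e <= 1.
Proof.
have -> : 1 = 1 `^ (1 - 2 * rho) :> R by rewrite powR1.
by rewrite /e ge0_ler_powR ?nnegrE// ltW.
Qed.

Lemma speed_ge j : a <= speed a b j.
Proof. by rewrite /speed; case: ifP => // _; exact: ltW. Qed.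

Lemma speed_le j : speed a b j <= b.
Proof. by rewrite /speed; case: ifP => // _; exact: ltW. Qed.

Variables (v0 : R * R -> 'cV[R[i]]_4) (U W : R -> R * R -> 'cV[R[i]]_4).
Hypotheses (solU : solves (symbol a b rho theta) v0 U)
  (solW : solves (ref_symbol a b rho theta) (fun xi => invmx T1 *m v0 xi) W).
Variable t : R.
Hypothesis t0 : 0 < t.

Let bound := 24 * (b + 3) * e * expR (- (a ^+ 2 / 4 * r `^ (2 * (1 - rho)) * t)).

(** The unknowns of the coupled systems are twice the coordinates in the basis [T1]; hence the
    factors 2 in front of [W] below. *)
Let W0E j : [/\ v0 xi (hi j) 0 - v0 xi (lo j) 0 = 2 * (invmx T1 *m v0 xi) (lo j) 0 &
  v0 xi (lo j) 0 + v0 xi (hi j) 0 = 2 * (invmx T1 *m v0 xi) (hi j) 0].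
Proof.
set w := invmx T1 *m v0 xi.
have -> : v0 xi = T1 *m w by rewrite /w mulKVmx// T1_unit.
by rewrite T1_mul_lo T1_mul_hi; split; ring.
Qed.

(** The factor [i] of [B1] couples the real part of the difference to the imaginary part of the sum.
    Each pair thus gives two real systems: [Re] of the difference with [Im] of the sum, and [Im] of
    the difference with minus [Re] of the sum, where the sign makes the coefficients agree. *)
Lemma pair_estimate j :
  [/\ `|(complex.Re (U t xi (hi j) 0) - complex.Re (U t xi (lo j) 0))
        - 2 * complex.Re (W t xi (lo j) 0)| <= bound * (4 * cvnorm (v0 xi)),
      `|(complex.Im (U t xi (lo j) 0) + complex.Im (U t xi (hi j) 0))
        - 2 * complex.Im (W t xi (hi j) 0)| <= bound * (4 * cvnorm (v0 xi)),
      `|(complex.Im (U t xi (hi j) 0) - complex.Im (U t xi (lo j) 0))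
        - 2 * complex.Im (W t xi (lo j) 0)| <= bound * (4 * cvnorm (v0 xi)) &
      `|(complex.Re (U t xi (lo j) 0) + complex.Re (U t xi (hi j) 0))
        - 2 * complex.Re (W t xi (hi j) 0)| <= bound * (4 * cvnorm (v0 xi))].
Proof.
have [_ U0 dU] := solU xi; have [_ W0 dW] := solW xi.
set be := speed a b j.
have bea : a <= be := speed_ge j; have beb : be <= b := speed_le j.
have be0 : 0 < be by apply: lt_le_trans bea.
have e0 : 0 <= e := powR_ge0 _ _.
have R10 : 0 <= R1 := powR_ge0 _ _.
have S0 : 0 <= S := powR_ge0 _ _.
have bee : be * e <= 4^-1 by apply: le_trans be4; rewrite ler_wpM2r.
have beE : be * e * R1 = be * r by rewrite -mulrA eR1.
have muE : be ^+ 2 * e ^+ 2 * R1 = slow_rate a b rho xi j.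
  by rewrite /slow_rate -mulrA eeR1.
have nu1 : R1 - be ^+ 2 * e ^+ 2 * R1 <= fast_rate a b rho theta xi j.
  rewrite muE /fast_rate -/r -/R1 -/S.
  have := powR_ge0 r (2 * (1 - rho)).
  by case: ifP => _; [|case: ifP => _]; lra.
have nu2 : fast_rate a b rho theta xi j <= R1 + S - be ^+ 2 * e ^+ 2 * R1.
  rewrite muE /fast_rate -/r -/R1.
  case: ifP => _; [|case: ifP => [/eqP h|_]]; rewrite -/S; try lra.
  by have -> : 2 * (1 - rho) = 2 * theta by lra.
have est := two_mode_estimate R10 e0 e1 S0 S_le be0 bee nu1 nu2.
rewrite beE muE in est.
have [q1 q2] := W0E j.
have q1r := congr1 (@complex.Re R) q1; have q1i := congr1 (@complex.Im R) q1.
have q2r := congr1 (@complex.Re R) q2; have q2i := congr1 (@complex.Im R) q2.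
have two (z : R[i]) : complex.Re (2 * z) = 2 * complex.Re z /\ complex.Im (2 * z) = 2 * complex.Im z.
  by rewrite !mulr_natl !mulr2n ReD ImD.
rewrite !ReIm (two _).1 in q1r; rewrite !ReIm (two _).2 in q1i.
rewrite !ReIm (two _).1 in q2r; rewrite !ReIm (two _).2 in q2i.
(* The slower speed [a] is put into the rate and the larger speed [b] into the constant, so one
   bound serves both pairs. *)
have boundE : 24 * (be + 3) * e * expR (- (slow_rate a b rho xi j * t / 4)) <= bound.
  rewrite /bound /slow_rate -/be -/r; apply: ler_pM; rewrite ?expR_ge0//.
  - by rewrite !mulr_ge0// addr_ge0// ltW.
  - by rewrite ler_wpM2r//; lra.
  - rewrite ler_expR lerN2.
    have : a ^+ 2 <= be ^+ 2 by rewrite lerXn2r ?nnegrE// ltW.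
    have h : 0 <= r `^ (2 * (1 - rho)) * t by rewrite mulr_ge0 ?powR_ge0// ltW.
    by move=> /(ler_wpM2r h); lra.
have n4 (x y : R) : `|x| <= 2 * cvnorm (v0 xi) -> `|y| <= 2 * cvnorm (v0 xi) ->
    24 * (be + 3) * e * expR (- (slow_rate a b rho xi j * t / 4)) * (`|x| + `|y|)
      <= bound * (4 * cvnorm (v0 xi)).
  move=> hx hy; apply: ler_pM => //.
  - by rewrite mulr_ge0 ?expR_ge0// !mulr_ge0// addr_ge0// ltW.
  - by lra.
have nR i := Re_le_cvnorm (v0 xi) i; have nI i := Im_le_cvnorm (v0 xi) i.
have cD (f g : R -> R) (x y : R) : f u @[u --> 0^'+] --> x -> g u @[u --> 0^'+] --> y ->
    f u + g u @[u --> 0^'+] --> x + y by move=> *; exact: cvgD.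
have cB (f g : R -> R) (x y : R) : f u @[u --> 0^'+] --> x -> g u @[u --> 0^'+] --> y ->
    f u - g u @[u --> 0^'+] --> x - y by move=> *; exact: cvgB.
have c2 (f : R -> R) (x : R) : f u @[u --> 0^'+] --> x ->
    2 * f u @[u --> 0^'+] --> 2 * x by move=> *; exact: cvgMr.
have [Url Uil] := U0 (lo j); have [Urh Uih] := U0 (hi j).
have [Wrl Wil] := W0 (lo j); have [Wrh Wih] := W0 (hi j).
have nB (f : 'I_4 -> R) i k : (forall i, `|f i| <= cvnorm (v0 xi)) ->
    `|f i - f k| <= 2 * cvnorm (v0 xi).
  by move=> h; rewrite mulr_natl mulr2n (le_trans (ler_normB _ _))// lerD.
have nD (f : 'I_4 -> R) i k : (forall i, `|f i| <= cvnorm (v0 xi)) ->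
    `|f i + f k| <= 2 * cvnorm (v0 xi).
  by move=> h; rewrite mulr_natl mulr2n (le_trans (ler_normD _ _))// lerD.
have nv := cvnorm_ge0 (v0 xi).
have colN (v : 'cV[R[i]]_4) i : (- v) i 0 = - v i 0 by rewrite mxE.
have [A1 A2] : `|(complex.Re (U t xi (hi j) 0) - complex.Re (U t xi (lo j) 0))
        - 2 * complex.Re (W t xi (lo j) 0)| <= bound * (4 * cvnorm (v0 xi)) /\
    `|(complex.Im (U t xi (lo j) 0) + complex.Im (U t xi (hi j) 0))
        - 2 * complex.Im (W t xi (hi j) 0)| <= bound * (4 * cvnorm (v0 xi)).
  have [] := est (fun u => complex.Re (U u xi (hi j) 0) - complex.Re (U u xi (lo j) 0))
    (fun u => complex.Im (U u xi (lo j) 0) + complex.Im (U u xi (hi j) 0))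
    (fun u => 2 * complex.Re (W u xi (lo j) 0))
    (fun u => 2 * complex.Im (W u xi (hi j) 0))
    (complex.Re (v0 xi (hi j) 0) - complex.Re (v0 xi (lo j) 0))
    (complex.Im (v0 xi (lo j) 0) + complex.Im (v0 xi (hi j) 0)) t.
  - exact: cB.
  - exact: cD.
  - by rewrite q1r; exact: c2.
  - by rewrite q2i; exact: c2.
  - move=> u u0; have [d1 _] := dU u u0 (hi j); have [d2 _] := dU u u0 (lo j).
    apply: is_derive_eq; rewrite !colN symbol_lo symbol_hi !ReIm -/be -/r; ring.
  - move=> u u0; have [_ d1] := dU u u0 (hi j); have [_ d2] := dU u u0 (lo j).
    apply: is_derive_eq; rewrite !colN symbol_lo symbol_hi !ReIm -/be -/r.
    by rewrite -/R1 -/S; field.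
  - move=> u u0; have [d1 _] := dW u u0 (lo j).
    apply: is_derive_eq; rewrite colN ref_symbol_lo !ReIm /GRing.scale/=; ring.
  - move=> u u0; have [_ d1] := dW u u0 (hi j).
    apply: is_derive_eq; rewrite colN ref_symbol_hi !ReIm /GRing.scale/=; ring.
  - exact: t0.
  - move=> B1 B2; split; [apply: (le_trans B1)|apply: (le_trans B2)].
      by apply: n4; [exact: (nB (fun i => _ (v0 xi i 0)))|exact: (nD (fun i => _ (v0 xi i 0)))].
    by apply: n4; [exact: (nB (fun i => _ (v0 xi i 0)))|exact: (nD (fun i => _ (v0 xi i 0)))].
have cN (f : R -> R) (x : R) : f u @[u --> 0^'+] --> x -> - f u @[u --> 0^'+] --> - x.
  by move=> *; exact: cvgN.
have [A3 A4] : `|(complex.Im (U t xi (hi j) 0) - complex.Im (U t xi (lo j) 0))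
        - 2 * complex.Im (W t xi (lo j) 0)| <= bound * (4 * cvnorm (v0 xi)) /\
    `|- (complex.Re (U t xi (lo j) 0) + complex.Re (U t xi (hi j) 0))
        - - (2 * complex.Re (W t xi (hi j) 0))| <= bound * (4 * cvnorm (v0 xi)).
  have [] := est (fun u => complex.Im (U u xi (hi j) 0) - complex.Im (U u xi (lo j) 0))
    (fun u => - (complex.Re (U u xi (lo j) 0) + complex.Re (U u xi (hi j) 0)))
    (fun u => 2 * complex.Im (W u xi (lo j) 0))
    (fun u => - (2 * complex.Re (W u xi (hi j) 0)))
    (complex.Im (v0 xi (hi j) 0) - complex.Im (v0 xi (lo j) 0))
    (- (complex.Re (v0 xi (lo j) 0) + complex.Re (v0 xi (hi j) 0))) t.
  - exact: cB.
  - by apply: cN; exact: cD.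
  - by rewrite q1i; exact: c2.
  - by rewrite q2r; apply: cN; exact: c2.
  - move=> u u0; have [_ d1] := dU u u0 (hi j); have [_ d2] := dU u u0 (lo j).
    apply: is_derive_eq; rewrite !colN symbol_lo symbol_hi !ReIm -/be -/r; ring.
  - move=> u u0; have [d1 _] := dU u u0 (hi j); have [d2 _] := dU u u0 (lo j).
    apply: is_derive_eq; rewrite !colN symbol_lo symbol_hi !ReIm -/be -/r.
    by rewrite -/R1 -/S; field.
  - move=> u u0; have [_ d1] := dW u u0 (lo j).
    apply: is_derive_eq; rewrite colN ref_symbol_lo !ReIm /GRing.scale/=; ring.
  - move=> u u0; have [d1 _] := dW u u0 (hi j).
    apply: is_derive_eq; rewrite colN ref_symbol_hi !ReIm /GRing.scale/=; ring.
  - exact: t0.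
  - move=> B1 B2; split; [apply: (le_trans B1)|apply: (le_trans B2)].
      by apply: n4; rewrite ?normrN; [exact: (nB (fun i => _ (v0 xi i 0)))|exact: (nD (fun i => _ (v0 xi i 0)))].
    by apply: n4; rewrite ?normrN; [exact: (nB (fun i => _ (v0 xi i 0)))|exact: (nD (fun i => _ (v0 xi i 0)))].
split=> //.
by rewrite -normrN opprB addrC; move: A4; rewrite opprK addrC.
Qed.

Lemma pointwise_estimate :
  cvnorm (U t xi - T1 *m W t xi) <= 3 * (bound * (4 * cvnorm (v0 xi))).
Proof.
have [_ nv] : True /\ 0 <= cvnorm (v0 xi) by split=> //; exact: cvnorm_ge0.
set K := bound * (4 * cvnorm (v0 xi)).
have K0 : 0 <= K.
  have [h _ _ _] := pair_estimate ord0; exact: le_trans (normr_ge0 _) h.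
have K30 : 0 <= 3 * K by rewrite mulr_ge0.
rewrite -ler_sqr ?nnegrE ?cvnorm_ge0//.
(* A component of [U - T1 W] is half the sum or difference of two errors of [pair_estimate], so its
   real and imaginary parts are at most [K]. *)
have comp i : complex.Re ((U t xi - T1 *m W t xi) i 0) ^+ 2 +
    complex.Im ((U t xi - T1 *m W t xi) i 0) ^+ 2 <= 2 * K ^+ 2.
  have sq (x : R) : `|x| <= K -> x ^+ 2 <= K ^+ 2.
    by move=> h; rewrite -real_normK ?num_real// lerXn2r ?nnegrE.
  have dE : (U t xi - T1 *m W t xi) i 0 = U t xi i 0 - (T1 *m W t xi) i 0.
    by rewrite !mxE.
  rewrite dE; have [j ij] := ord4_lo_hi i.
  have [] := pair_estimate j; rewrite -/K.
  rewrite !ler_norml => /andP[a1 a2] /andP[a3 a4] /andP[a5 a6] /andP[a7 a8].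
  rewrite mulr_natl mulr2n; apply: lerD; apply: sq; rewrite ler_norml.
    by case: ij => ->; rewrite ?T1_mul_lo ?T1_mul_hi !ReIm; apply/andP; split; lra.
  by case: ij => ->; rewrite ?T1_mul_lo ?T1_mul_hi !ReIm; apply/andP; split; lra.
rewrite cvnorm_sqr; apply: (@le_trans _ _ (\sum_(i < 4) (2 * K ^+ 2))).
  by apply: ler_sum => i _; exact: comp.
rewrite sumr_const card_ord.
have -> : (2 * K ^+ 2) *+ 4 = 8 * K ^+ 2 by ring.
have -> : (3 * K) ^+ 2 = 9 * K ^+ 2 by ring.
by rewrite ler_wpM2r ?sqr_ge0// ler_nat.
Qed.

End Pointwise.

(* Unlike [ge0_le_integral], this does not require measurability. *)
Lemma ge0_le_integral_nonmeas d (T : measurableType d) (R : realType)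
    (mu : {measure set T -> \bar R}) (f g : T -> \bar R) :
  (forall x, 0 <= f x)%E -> (forall x, f x <= g x)%E ->
  (\int[mu]_x f x <= \int[mu]_x g x)%E.
Proof.
move=> f0 fg; have g0 x : (0 <= g x)%E by exact: le_trans (fg x).
rewrite !ge0_integralTE//; apply: le_ereal_sup => _ [h hf <-].
by exists h => // x; apply: le_trans (fg x).
Qed.

(** * The cut-off function *)

Section CutOff.
Context {R : realType}.
Implicit Types (chi : R * R -> R).

Lemma enorm_ge0 (xi : R * R) : 0 <= enorm xi.
Proof. exact: sqrtr_ge0. Qed.

Lemma cutoff_bounded chi : continuous chi ->
  exists2 M : R, 0 < M & forall xi, enorm xi <= 1 -> `|chi xi| <= M.
Proof.
move=> cchi.
have cpt : compact (chi @` (`[-1, 1]%classic `*` `[-1, 1]%classic)).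
  apply: continuous_compact; first exact: continuous_subspaceT.
  by apply: compact_setX; exact: segment_compact.
have [M [_ hM]] := compact_bounded cpt.
exists (Num.max M 0 + 1); first by rewrite ltr_wpDl// le_max lexx orbT.
move=> xi r1; apply: (hM (Num.max M 0 + 1)).
  by rewrite ltr_pwDr// le_max lexx.
exists xi => //.
have : enorm xi ^+ 2 = xi.1 ^+ 2 + xi.2 ^+ 2.
  by rewrite sqr_sqrtr// addr_ge0// sqr_ge0.
have := enorm_ge0 xi; move: (enorm xi) r1 => r r1 r0 rE.
split; rewrite /= in_itv/= -ler_norml -(@expr_le1 _ 2)// real_normK ?num_real//.
  by have := sqr_ge0 xi.2; nra.
by have := sqr_ge0 xi.1; nra.
Qed.

Lemma cutoff_support chi (eps : R) xi :
  tsupport chi `<=` [set xi | enorm xi < eps] -> chi xi != 0 -> enorm xi < eps.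
Proof. by move=> sub chi0; apply: sub; exact: subset_closure. Qed.

Lemma cvnorm_scale (k : R) (v : 'cV[R[i]]_4) : cvnorm (k%:C *: v) = `|k| * cvnorm v.
Proof.
rewrite -[LHS]ger0_norm ?cvnorm_ge0// -sqrtr_sqr cvnorm_sqr.
rewrite -[in RHS](ger0_norm (cvnorm_ge0 v)) -normrM -sqrtr_sqr exprMn cvnorm_sqr.
congr Num.sqrt; rewrite mulr_sumr; apply: eq_bigr => i _.
by rewrite mxE Re_scale Im_scale; ring.
Qed.

End CutOff.

(** * Choice of the constants and final exponents *)

Section Assembly.
Context {R : realType}.

(** The radius [(4 b) ^ (- 1 / p)] ensures [b * e <= 1/4], under which the slow root is real and
    small; [1/2] keeps the disc inside [box]. *)
Lemma small_radius (b p : R) : 0 < b -> 0 < p ->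
  exists2 eps0 : R, 0 < eps0 <= 2^-1 & forall r, 0 <= r -> r < eps0 -> b * r `^ p <= 4^-1.
Proof.
move=> b0 p0.
pose d : R := (4 * b)^-1 `^ p^-1.
have d0 : 0 < d by rewrite powR_gt0// invr_gt0 mulr_gt0.
exists (Num.min 2^-1 d); first by rewrite lt_min d0 ge_min lexx invr_gt0 ltr0n.
move=> r r0; rewrite lt_min => /andP[_ rd].
have : r `^ p <= d `^ p by rewrite ge0_ler_powR ?nnegrE// ltW.
rewrite /d -powRrM mulVf ?gt_eqF// powRr1 ?invr_ge0 ?mulr_ge0 ?(ltW b0)//.
move=> /(ler_wpM2l (ltW b0)) h; apply: (le_trans h).
by rewrite invfM mulrCA divff ?mulr1// gt_eqF.
Qed.

(** Solutions are prescribed frequency by frequency, so [v] comes without measurability in [xi]; the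
    integrals are compared as suprema over simple functions. *)
Lemma Lp_norm2_le (v : R * R -> 'cV[R[i]]_4) (h : R * R -> R) (B : R) :
  0 <= B -> (forall xi, cvnorm (v xi) ^+ 2 <= h xi) ->
  (\int[area]_xi (h xi)%:E <= (B ^+ 2)%:E)%E ->
  (Lp_norm 2%:E v <= B%:E)%E.
Proof.
move=> B0 vh hB; apply/(Lp_norm_le v (ltr0n R 2) B0).
rewrite powR_mulrn//; apply: le_trans hB.
apply: ge0_le_integral_nonmeas => xi; first by rewrite lee_fin powR_ge0.
by rewrite lee_fin powR_mulrn ?cvnorm_ge0.
Qed.

(** The truncation level is proportional to [A] and must be positive, so the norm [N], possibly 0,
    is replaced by majorants [A = n + e / C] with [e] arbitrarily small. *)
Lemma le_mule_of_fin (x N : \bar R) (C : R) : 0 < C -> (0 <= N)%E -> (N < +oo)%E ->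
  (forall A : R, 0 < A -> (N <= A%:E)%E -> (x <= (C * A)%:E)%E) -> (x <= C%:E * N)%E.
Proof.
move=> C0; case: N => [n| |]// n0 _ H; apply/lee_addgt0Pr => e e0.
rewrite -EFinM -EFinD; rewrite lee_fin in n0.
have -> : C * n + e = C * (n + e / C) by field; rewrite gt_eqF.
have eC : 0 < e / C by rewrite divr_gt0.
by apply: H; rewrite ?lee_fin; lra.
Qed.

(** The exponent on the left is twice the claimed one with [(1 - 2 rho) / k] in place of [q], and
    [2 theta - 1 < 1 - 2 rho] when [rho + theta < 1]. *)
Lemma decay_exponents (rho theta s m t : R) (k := 2 - 2 * rho) : 0 <= rho -> rho < 2^-1 ->
  0 <= t -> 0 < m ->
  (1 + t) `^ (- (2 * (s + (1 - 2 * rho)) / k)) *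
    (((1 + t) `^ k^-1) ^- 2) `^ ((2 - m) / m) <=
  ((1 + t) `^ (- (s / k) - (2 - m) / (m * k) - q rho theta)) ^+ 2.
Proof.
move=> rho0 rho1 t0 m0.
have k0 : 0 < k by rewrite /k; lra.
have t1 : 0 < 1 + t by lra.
rewrite -[_ ^- 2]powR_invn ?powR_ge0// -!powRrM -powRD_gt0// -[leRHS]powR_mulrn ?powR_ge0//.
rewrite -powRrM ler_powR//; first by lra.
have qk : q rho theta <= (1 - 2 * rho) / k.
  rewrite /q; case: ifP => h //; rewrite ler_pM2r ?invr_gt0//; lra.
rewrite [leLHS](_ : _ =
   (- (s / k) - (2 - m) / (m * k) - (1 - 2 * rho) / k) * 2%:R); last first.
  by field; rewrite !gt_eqF.
by rewrite ler_pM2r//; lra.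
Qed.

End Assembly.

Theorem theorem4p1 (R : realType) (a b rho theta s m : R)
    (ha : 0 < a) (hab : a < b)
    (hrho0 : 0 <= rho) (hrho : rho < 2^-1)
    (htheta : 2^-1 < theta) (htheta1 : theta <= 1)
    (hs : 0 <= s) (hm1 : 1 <= m) (hm2 : m <= 2) :
  exists eps0 : R, 0 < eps0 /\
  forall (eps : R) (chi : R * R -> R),
    0 < eps -> eps < eps0 ->
    smooth chi -> tsupport chi `<=` [set xi | enorm xi < eps] ->
  exists C : R, 0 < C /\
  forall (U0 U0hat : R * R -> 'cV[R[i]]_4)
         (Uhat Utildehat : R -> R * R -> 'cV[R[i]]_4),
    in_Lp m%:E U0 ->
    is_fourier m U0 U0hat ->
    solves (symbol a b rho theta) U0hat Uhat ->
    solves (ref_symbol a b rho theta)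
      (fun xi => invmx T1 *m U0hat xi) Utildehat ->
  forall t : R, 0 <= t ->
    (Hdot_norm_hat s
       (fun xi => (chi xi)%:C *: (Uhat t xi - T1 *m Utildehat t xi))
     <= (C * (1 + t) `^ (- (s / (2 - 2 * rho))
                         - (2 - m) / (m * (2 - 2 * rho))
                         - q rho theta))%R%:E
        * Lp_norm m%:E U0)%E.
Proof.
have b0 : 0 < b by exact: lt_trans hab.
have p0 : 0 < 1 - 2 * rho by lra.
have k0 : 0 < 2 * (1 - rho) by lra.
have kE : 2 * (1 - rho) = 2 - 2 * rho by ring.
have [eps0 /andP[eps00 eps02] small] := small_radius b0 p0.
exists eps0; split=> // eps chi eps_gt0 eps_lt chi_smooth chi_supp.
have [M M0 chiM] := cutoff_bounded (chi_smooth 0%N).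
(* The gain [|xi| ^ (1 - 2 rho)] raises the order of the multiplier from [s] to this value. *)
have si0 : 0 <= s + (1 - 2 * rho) by rewrite addr_ge0// ltW.
have c0 : 0 < a ^+ 2 / 4 by rewrite divr_gt0// exprn_gt0.
have [C1 C10 dom] := weight_dominates si0 c0 k0.
pose K := 3 * (24 * (b + 3)) * 4.
have K0 : 0 < K by rewrite !mulr_gt0// addr_gt0.
pose B0 := (M * K) ^+ 2 * C1.
have B00 : 0 < B0 by rewrite mulr_gt0// exprn_gt0// mulr_gt0.
have pi20 : 0 < 2 + pi ^+ 2 :> R by rewrite ltr_wpDr// sqr_ge0.
have [KF KF0 fourier_est] := @fourier_multiplier R.
pose C2 : R := KF * (2 + pi ^+ 2) * B0.
have C20 : 0 < C2 by rewrite mulr_gt0// mulr_gt0.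
(* [C2] bounds the square of the norm; [C2 <= (1 + C2) ^ 2] avoids a square root. *)
exists (1 + C2); split; first by rewrite addr_gt0.
move=> U0 U0hat Uhat Utildehat U0L FU solU solW t t0.
set D := (1 + t) `^ _.
have D0 : 0 < D by rewrite powR_gt0//; lra.
have CD0 : 0 < (1 + C2) * D by rewrite mulr_gt0// addr_gt0.
have m0 : 0 < m by lra.
have [_ Nfin] := U0L.
apply: le_mule_of_fin => //; first exact: Lp_norm_ge0.
move=> A A0 NA.
set T := (1 + t) `^ (2 * (1 - rho))^-1.
have T0 : 0 < T by rewrite powR_gt0//; lra.
set B := B0 * (1 + t) `^ (- (2 * (s + (1 - 2 * rho)) / (2 * (1 - rho)))).
have B_ge0 : 0 <= B by rewrite mulr_ge0 ?powR_ge0// ltW.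
have al0 : 0 <= (2 + pi ^+ 2) * B by rewrite mulr_ge0// ltW.
have be0 : 0 < T ^- 2 by rewrite invr_gt0 exprn_gt0.
have := fourier_est m U0 U0hat (weight B T) ((2 + pi ^+ 2) * B) (T ^- 2) A
  hm1 hm2 U0L FU (measurable_weight B T) (fun xi => weight_ge0 T xi B_ge0) al0 be0
  (fun xi => weight_le T xi B_ge0) (integral_weight_le B_ge0 T0) A0 NA.
move=> est.
apply: (@Lp_norm2_le R _ (fun xi => weight B T xi * cvnorm (U0hat xi) ^+ 2)).
- by rewrite mulr_ge0// ltW.
- move=> xi; rewrite !cvnorm_scale.
  have rhs0 : 0 <= weight B T xi * cvnorm (U0hat xi) ^+ 2.
    by rewrite mulr_ge0 ?sqr_ge0// weight_ge0.
  have [->|chi0] := eqVneq (chi xi) 0; first by rewrite normr0 mul0r mulr0 expr0n.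
  have reps := cutoff_support chi_supp chi0.
  have r0 := enorm_ge0 xi.
  have reps0 : enorm xi < eps0 := lt_trans reps eps_lt.
  have r2 : enorm xi <= 2^-1 := ltW (lt_le_trans reps0 eps02).
  have r1 : enorm xi <= 1 by rewrite (le_trans r2)// invf_le1 ?ler1n ?ltr0n.
  have chiM' := chiM _ r1.
  have weightE : weight B T xi = (M * K) ^+ 2 *
      weight (C1 * (1 + t) `^ (- (2 * (s + (1 - 2 * rho)) / (2 * (1 - rho))))) T xi.
    by rewrite /weight /B /B0; case: ifP => _; ring.
  move: t0; rewrite le_eqVlt => /predU1P[t0|t0].
    (* The pointwise estimate is for positive times; at [t = 0] the difference vanishes by the
       initial conditions. *)
    have [h1 _ _] := solU xi; have [h2 _ _] := solW xi.
    rewrite -t0 h1 h2 mulKVmx ?T1_unit// subrr.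
    have -> : cvnorm (0 : 'cV[R[i]]_4) = 0.
      by have := cvnorm_scale 0 (0 : 'cV[R[i]]_4); rewrite normr0 mul0r scaler0.
    by rewrite !mulr0 expr0n.
  have pw := pointwise_estimate ha hab hrho htheta r1 (small _ r0 reps0) solU solW t0.
  set r := enorm xi in r0 r2 r1 reps reps0 pw *.
  set E := expR _ in pw.
  have E0 : 0 < E by exact: expR_gt0.
  have MK0 : 0 <= M * K by rewrite mulr_ge0// ltW.
  have rs0 : 0 <= r `^ s := powR_ge0 _ _.
  have re0 : 0 <= r `^ (1 - 2 * rho) := powR_ge0 _ _.
  have rr : r `^ s * r `^ (1 - 2 * rho) <= r `^ (s + (1 - 2 * rho)).
    move: r0; rewrite le_eqVlt => /predU1P[<-|rp]; last by rewrite powRD_gt0.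
    by rewrite [X in _ * X]powR0 ?gt_eqF// mulr0 powR_ge0.
  have := dom t xi (ltW t0) r2; rewrite -/r -/E => domt.
  rewrite weightE -mulrA.
  apply: (@le_trans _ _ ((M * K) ^+ 2 * ((r `^ (s + (1 - 2 * rho)) * E) ^+ 2 *
    cvnorm (U0hat xi) ^+ 2))); last first.
    by rewrite ler_wpM2l ?sqr_ge0// ler_wpM2r ?sqr_ge0.
  rewrite -!exprMn lerXn2r ?nnegrE//.
  + by rewrite !mulr_ge0 ?normr_ge0 ?cvnorm_ge0.
  + by rewrite mulr_ge0 ?MK0// mulr_ge0 ?cvnorm_ge0// mulr_ge0 ?powR_ge0// ltW.
  rewrite ger0_norm//.
  apply: (@le_trans _ _ (r `^ s * (M * (K * r `^ (1 - 2 * rho) * E * cvnorm (U0hat xi))))).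
    rewrite ler_wpM2l//; apply: ler_pM; rewrite ?normr_ge0 ?cvnorm_ge0//.
    by apply: (le_trans pw); rewrite /K le_eqVlt; apply/orP; left; apply/eqP; ring.
  have -> : r `^ s * (M * (K * r `^ (1 - 2 * rho) * E * cvnorm (U0hat xi))) =
    M * K * (r `^ s * r `^ (1 - 2 * rho) * (E * cvnorm (U0hat xi))) by ring.
  have -> : M * K * (r `^ (s + (1 - 2 * rho)) * E * cvnorm (U0hat xi)) =
    M * K * (r `^ (s + (1 - 2 * rho)) * (E * cvnorm (U0hat xi))) by ring.
  by rewrite ler_wpM2l// ler_wpM2r// mulr_ge0 ?cvnorm_ge0// ltW.
- apply: (le_trans est); rewrite lee_fin.
  have := @decay_exponents R rho theta s m t hrho0 hrho t0 m0.
  rewrite -kE -/T kE -/D => hD.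
  set P1 := (1 + t) `^ _ in hD; set P2 := _ `^ _ in hD.
  have -> : KF * ((2 + pi ^+ 2) * B * (T ^- 2) `^ ((2 - m) / m) * A ^+ 2) = C2 * (P1 * P2) * A ^+ 2.
    by rewrite /C2 /B /P1 /P2 kE; ring.
  rewrite !exprMn ler_wpM2r ?sqr_ge0//; apply: ler_pM => //.
  + exact: ltW.
  + by rewrite mulr_ge0// powR_ge0.
  + by nra.
Qed.
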